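(* Let $I\subseteq\mathbb{R}$ be a nonempty open interval and let $(f,g)\in\mathscr{C}_1(I)$. Consider the following statements. (i) There exists a continuous strictly monotone function $h:I\to\mathbb{R}$ such that $\mathbb{C}_{f,g}(x,y)=\mathbb{A}_h(x,y)$ for all $x,y\in I$. (ii) $\mathbb{C}_{f,g}$ is bisymmetric, i.e. $\mathbb{C}_{f,g}(\mathbb{C}_{f,g}(x,y),\mathbb{C}_{f,g}(u,v))=\mathbb{C}_{f,g}(\mathbb{C}_{f,g}(x,u),\mathbb{C}_{f,g}(y,v))$ for all $x,y,u,v\in I$. (iii) There exist real constants $\alpha,\beta,\gamma,\delta,\varepsilon,\eta$ with $(\alpha,\beta,\gamma)\neq(0,0,0)$ such that $\alpha f^2+\beta fg+\gamma g^2+\delta f+\varepsilon g+\eta=0$ on $I$. (iv) There exist real constants $a,b,c$ such that $a(f')^2+bf'g'+c(g')^2=(W^{2,1}_{f,g})^{2/3}$ on $I$. (v) Let $h:I\to\mathbb{R}$ be an antiderivative of $(W^{2,1}_{f,g})^{1/3}$, and let $F:=f'/h'$, $G:=g'/h'$. Then $\mathbb{B}_{F,G}(x,y)=\mathbb{A}_h(x,y)$ for all $x,y\in I$. (vi) For $h:I\to\mathbb{R}$ an antiderivative of $(W^{2,1}_{f,g})^{1/3}$, one has $\mathbb{C}_{f,g}(x,y)=\mathbb{A}_h(x,y)$ for all $x,y\in I$. (vii) The function \[ \frac{3W^{4,1}_{f,g}+12W^{3,2}_{f,g}}{\big(W^{2,1}_{f,g}\big)^{5/3}}-5\,\frac{\big(W^{3,1}_{f,g}\big)^2}{\big(W^{2,1}_{f,g}\big)^{8/3}}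 \] is constant on $I$. Then statements (i), (ii), (iii) are equivalent. If, in addition, $(f,g)\in\mathscr{C}_2(I)$, then statements (i)–(vi) are all equivalent. If, in addition, $(f,g)\in\mathscr{C}_4(I)$, then statements (i)–(vii) are all equivalent.
   Context: $I$ is a nonempty open interval. For a continuous strictly monotone $\varphi:I\to\mathbb{R}$, the quasiarithmetic mean is $\mathbb{A}_\varphi(x,y):=\varphi^{-1}\big(\frac{\varphi(x)+\varphi(y)}{2}\big)$. For $F,G:I\to\mathbb{R}$ with $G$ nowhere zero and $F/G$ continuous and strictly monotone, the Bajraktarević mean is $\mathbb{B}_{F,G}(x,y):=(F/G)^{-1}\big(\frac{F(x)+F(y)}{G(x)+G(y)}\big)$. For differentiable $f,g$ with $g'$ nowhere zero and $f'/g'$ strictly monotone, the Cauchy mean is $\mathbb{C}_{f,g}(x,y):=(f'/g')^{-1}\big(\frac{f(x)-f(y)}{g(x)-g(y)}\big)$ if $x\neq y$ and $\mathbb{C}_{f,g}(x,x):=x$. The class $\mathscr{C}_1(I)$ consists of all pairs $(f,g)$ of continuously differentiable functions $f,g:I\to\mathbb{R}$ with $g'$ nowhere zero on $I$ and $f'/g'$ strictly monotone on $I$. For $n\ge 2$, $\mathscr{C}_n(I)$ consists of all pairs $(f,g)$ of $n$ times continuously differentiable functions $f,g:I\to\mathbb{R}$ with $g'$ nowhere zero on $I$ and $(f'/g')'$ nowhere zero on $I$. For $i,j\ge 0$, $W^{i,j}_{f,g}:=f^{(i)}g^{(j)}-f^{(j)}g^{(i)}$ (the determinant with first row $f^{(i)},f^{(j)}$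 and second row $g^{(i)},g^{(j)}$). For $(f,g)\in\mathscr{C}_2(I)$ one has $W^{2,1}_{f,g}=(g')^2(f'/g')'$, which is nowhere zero. Powers $(W^{2,1}_{f,g})^{k/3}$ are understood as $k$-th powers of the real cube root. *)

(* Defs.v *)
From Stdlib Require Import Reals Lra ClassicalEpsilon.
From Coquelicot Require Import Coquelicot.
Open Scope R_scope.

Definition inI (a b : Rbar) (x : R) : Prop := Rbar_lt a x /\ Rbar_lt x b.

Definition strict_mono_on (a b : Rbar) (h : R -> R) : Prop :=
  (forall x y, inI a b x -> inI a b y -> x < y -> h x < h y) \/
  (forall x y, inI a b x -> inI a b y -> x < y -> h y < h x).

Definition cont_on (a b : Rbar) (h : R -> R) : Prop :=
  forall x, inI a b x -> continuous h x.

(** Inverse of phi restricted to I (chosen by Hilbert's epsilon; unique when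
    phi is strictly monotone on I and y lies in phi(I)). *)
Definition inv_on (a b : Rbar) (phi : R -> R) (y : R) : R :=
  epsilon (inhabits 0) (fun z => inI a b z /\ phi z = y).

Definition qa_mean (a b : Rbar) (phi : R -> R) (x y : R) : R :=
  inv_on a b phi ((phi x + phi y) / 2).

Definition bajr_mean (a b : Rbar) (F G : R -> R) (x y : R) : R :=
  inv_on a b (fun t => F t / G t) ((F x + F y) / (G x + G y)).

Definition cauchy_mean (a b : Rbar) (f g : R -> R) (x y : R) : R :=
  if Req_EM_T x y then x
  else inv_on a b (fun t => Derive f t / Derive g t) ((f x - f y) / (g x - g y)).

Definition Cn_on (n : nat) (a b : Rbar) (f : R -> R) : Prop :=
  (forall k x, (k < n)%nat -> inI a b x -> ex_derive (Derive_n f k) x) /\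
  (forall x, inI a b x -> continuous (Derive_n f n) x).

Definition class_C1 (a b : Rbar) (f g : R -> R) : Prop :=
  Cn_on 1 a b f /\ Cn_on 1 a b g /\
  (forall x, inI a b x -> Derive g x <> 0) /\
  strict_mono_on a b (fun t => Derive f t / Derive g t).

Definition class_Cn (n : nat) (a b : Rbar) (f g : R -> R) : Prop :=
  Cn_on n a b f /\ Cn_on n a b g /\
  (forall x, inI a b x -> Derive g x <> 0) /\
  (forall x, inI a b x -> Derive (fun t => Derive f t / Derive g t) x <> 0).

Definition W (i j : nat) (f g : R -> R) (x : R) : R :=
  Derive_n f i x * Derive_n g j x - Derive_n f j x * Derive_n g i x.

Definition cbrt (x : R) : R :=
  if Rlt_dec 0 x then Rpower x (1/3)
  else if Rlt_dec x 0 then - Rpower (- x) (1/3) else 0.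

Definition Wpow3 (k : nat) (f g : R -> R) (x : R) : R := (cbrt (W 2 1 f g x)) ^ k.

Definition is_antider_W (a b : Rbar) (f g h : R -> R) : Prop :=
  forall x, inI a b x -> is_derive h x (Wpow3 1 f g x).

Definition st_i (a b : Rbar) (f g : R -> R) : Prop :=
  exists h : R -> R, cont_on a b h /\ strict_mono_on a b h /\
    forall x y, inI a b x -> inI a b y -> cauchy_mean a b f g x y = qa_mean a b h x y.

Definition st_ii (a b : Rbar) (f g : R -> R) : Prop :=
  forall x y u v, inI a b x -> inI a b y -> inI a b u -> inI a b v ->
    cauchy_mean a b f g (cauchy_mean a b f g x y) (cauchy_mean a b f g u v) =
    cauchy_mean a b f g (cauchy_mean a b f g x u) (cauchy_mean a b f g y v).

Definition st_iii (a b : Rbar) (f g : R -> R) : Prop :=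
  exists al be ga de ep et : R, ~ (al = 0 /\ be = 0 /\ ga = 0) /\
    forall x, inI a b x ->
      al * f x ^ 2 + be * f x * g x + ga * g x ^ 2 + de * f x + ep * g x + et = 0.

Definition st_iv (a b : Rbar) (f g : R -> R) : Prop :=
  exists p q r : R, forall x, inI a b x ->
    p * Derive f x ^ 2 + q * Derive f x * Derive g x + r * Derive g x ^ 2 = Wpow3 2 f g x.

Definition st_v (a b : Rbar) (f g : R -> R) : Prop :=
  forall h : R -> R, is_antider_W a b f g h ->
    let F := fun t => Derive f t / Derive h t in
    let G := fun t => Derive g t / Derive h t in
    forall x y, inI a b x -> inI a b y -> bajr_mean a b F G x y = qa_mean a b h x y.

Definition st_vi (a b : Rbar) (f g : R -> R) : Prop :=
  forall h : R -> R, is_antider_W a b f g h ->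
    forall x y, inI a b x -> inI a b y -> cauchy_mean a b f g x y = qa_mean a b h x y.

Definition st_vii (a b : Rbar) (f g : R -> R) : Prop :=
  exists K : R, forall x, inI a b x ->
    (3 * W 4 1 f g x + 12 * W 3 2 f g x) / Wpow3 5 f g x
    - 5 * (W 3 1 f g x ^ 2 / Wpow3 8 f g x) = K.

(* Main.v *)
(** From a conic to a mean: if (f, g) runs on a conic, then in the variable h of its Hamiltonian flow
    the tangent vector (F, G) solves a linear system with a constant trace-free matrix A.  The
    exponential of A splits into its even and odd parts around m = A_h(x, y), so that both the chord
    (f x - f y, g x - g y) and the sum (F x + F y, G x + G y) are multiples of (F m, G m).  Up to a
    constant factor, h is an antiderivative of the cube root of W^{2,1}, which gives (iv), (v), (vi).

    From bisymmetry to a conic: a bisymmetric Cauchy mean M refines a grid x_0 < ... < x_N on which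
    M(x_i, x_j) depends only on i + j.  On such a grid the steps v_i of the points
    P_i = (f x_i, g x_i) satisfy v_{i-1} + v_{i+1} = c v_i with a single constant c, whence the P_i
    lie on a conic.  Five points of the curve determine the conic, so all the dyadic grids give the
    same one, and the dyadic points are dense.

    From (v) to (vi): integrate F x + F y = (f'/g')(m) (G x + G y) along the pairs (x, y) with fixed
    h-mean m.  For (vii): the function there is -9 Psi, where F'' = Psi F and G'' = Psi G with respect
    to h. *)
Require Import Defs.
From Stdlib Require Import Reals Lra Lia Psatz Classical ClassicalEpsilon Ranalysis5.
From Coquelicot Require Import Coquelicot.
Open Scope R_scope.

(** * Calculus on an open interval *)

(** In class C_1 neither f nor g has a second derivative, and a generator of the mean is not known
    to be differentiable.

    For a conic Q = 0 the flow is (F, G) = (-Q_v, Q_u) along the curve. These functions are affine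
    in (f, g), hence differentiable, while f' = k F and g' = k G with k merely continuous: passing
    to the variable h with h' = k moves all the lack of smoothness into h. The matrix A is the
    Hessian of Q turned by a right angle, so its trace vanishes and, by Cayley-Hamilton, its square
    is scalar. Hence exp(tA) = C(t) + S(t) A with only two scalar functions.

    The exponent 1/3 arises as follows. W^{2,1} carries three factors k, two from f' and g' and one
    from the differentiation in h; what remains is F'G - FG' in the variable h, a multiple of the
    leading form of Q at (F, G), which is constant along the flow. *)

Ltac splits := repeat match goal with |- _ /\ _ => split end.

Ltac solve_derive :=
  auto_derive;
  [repeat match goal with |- _ /\ _ => split | |- True => exact I end;
   try (eexists; eassumption); auto
  |(* [auto_derive] eta-expands the functions it differentiates. *)
   repeat match goal with
   | H : is_derive ?f ?x _ |- _ =>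
     try change (Derive (fun y : R => f y)) with (Derive f);
     rewrite ?(is_derive_unique f x _ H); clear H
   end].

Lemma inI_convex (a b : Rbar) (x y z : R) :
  inI a b x -> inI a b y -> x <= z <= y -> inI a b z.
Proof.
  unfold inI; destruct a, b; simpl; try tauto; lra.
Qed.

Lemma inI_locally (a b : Rbar) (x : R) : inI a b x -> locally x (inI a b).
Proof.
  intros [Ha Hb]; apply filter_and; [exact (open_Rbar_gt' x a Ha) | exact (open_Rbar_lt' x b Hb)].
Qed.

Lemma inI_inhabited (a b : Rbar) : Rbar_lt a b -> exists x, inI a b x.
Proof.
  unfold inI; destruct a as [a| |], b as [b| |]; simpl; try tauto; intros H.
  - exists ((a + b) / 2); lra.
  - exists (a + 1); lra.
  - exists (b - 1); lra.
  - exists 0; tauto.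
Qed.

Lemma inI_right (a b : Rbar) (x : R) : inI a b x -> exists y, inI a b y /\ x < y.
Proof.
  intros Hx; destruct (inI_locally a b x Hx) as [d Hd].
  assert (Hp := cond_pos d); exists (x + d / 2); split; [|lra].
  apply Hd, Rabs_def1; unfold minus, plus, opp; simpl; lra.
Qed.

Lemma cont_on_ivt (a b : Rbar) (h : R -> R) (x y c : R) :
  cont_on a b h -> inI a b x -> inI a b y ->
  Rmin (h x) (h y) <= c <= Rmax (h x) (h y) ->
  exists z, inI a b z /\ h z = c.
Proof.
  intros Hh.
  assert (W : forall x y, x <= y -> inI a b x -> inI a b y ->
    Rmin (h x) (h y) <= c <= Rmax (h x) (h y) -> exists z, inI a b z /\ h z = c).
  { clear x y; intros x y [Hxy| ->] Hx Hy Hc.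
    2: { exists y; split; auto; revert Hc; unfold Rmin, Rmax.
         destruct (Rle_dec (h y) (h y)); lra. }
    assert (P : forall s, x <= s <= y -> inI a b s) by (intros s; apply inI_convex; auto).
    destruct (Rle_dec (h x) (h y)) as [L|L].
    - rewrite Rmin_left, Rmax_right in Hc by lra.
      destruct (f_interv_is_interv h x y c Hxy Hc) as [z [Hz E]].
      { intros s Hs; apply continuity_pt_filterlim, Hh, P, Hs. }
      exists z; auto.
    - rewrite Rmin_right, Rmax_left in Hc by lra.
      destruct (f_interv_is_interv (fun s => - h s) x y (- c) Hxy) as [z [Hz E]].
      { lra. }
      { intros s Hs; apply continuity_pt_filterlim.
        apply (continuous_opp (V := R_NormedModule) h), Hh, P, Hs. }
      exists z; split; auto; lra. }
  intros Hx Hy Hc; destruct (Rle_dec x y).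
  - apply (W x y); auto.
  - apply (W y x); auto; [lra|]; rewrite Rmin_comm, Rmax_comm; auto.
Qed.

Lemma nonzero_same_sign (a b : Rbar) (k : R -> R) :
  cont_on a b k -> (forall x, inI a b x -> k x <> 0) ->
  forall x y, inI a b x -> inI a b y -> 0 < k x * k y.
Proof.
  intros Hk Hn x y Hx Hy.
  destruct (Rlt_dec 0 (k x * k y)) as [|N]; auto; exfalso.
  destruct (cont_on_ivt a b k x y 0) as [z [Hz E]]; auto.
  - unfold Rmin, Rmax; destruct (Rle_dec (k x) (k y)); nra.
  - exact (Hn z Hz E).
Qed.

Lemma nonzero_sign (a b : Rbar) (k : R -> R) :
  cont_on a b k -> (forall x, inI a b x -> k x <> 0) ->
  (forall x, inI a b x -> 0 < k x) \/ (forall x, inI a b x -> k x < 0).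
Proof.
  intros Hk Hn.
  destruct (classic (exists x, inI a b x /\ 0 < k x)) as [[x [Hx P]]|N].
  - left; intros y Hy; assert (H := nonzero_same_sign a b k Hk Hn x y Hx Hy); nra.
  - right; intros y Hy; assert (H := Hn y Hy).
    destruct (Rlt_dec 0 (k y)); [exfalso; eauto | lra].
Qed.

Lemma cont_on_derive (a b : Rbar) (h k : R -> R) :
  (forall x, inI a b x -> is_derive h x (k x)) -> cont_on a b h.
Proof.
  intros H x Hx; apply (ex_derive_continuous (V := R_NormedModule)); exists (k x); auto.
Qed.

Lemma mvt_on (a b : Rbar) (h k : R -> R) (x y : R) :
  (forall x, inI a b x -> is_derive h x (k x)) -> inI a b x -> inI a b y -> x < y ->
  exists z, h y - h x = k z * (y - x) /\ x < z < y.
Proof.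
  intros H Hx Hy L; apply MVT_cor2; auto.
  intros z Hz; apply is_derive_Reals, H, (inI_convex a b x y); auto.
Qed.

Lemma strict_mono_derive (a b : Rbar) (h k : R -> R) :
  (forall x, inI a b x -> is_derive h x (k x)) ->
  (forall x, inI a b x -> k x <> 0) -> cont_on a b k -> strict_mono_on a b h.
Proof.
  intros H Hn Hk; destruct (nonzero_sign a b k Hk Hn) as [P|P]; [left|right];
    intros x y Hx Hy L; destruct (mvt_on a b h k x y H Hx Hy L) as [z [E Hz]];
    assert (Kz := P z (inI_convex a b x y z Hx Hy ltac:(lra))); nra.
Qed.

Lemma derive_zero_const (a b : Rbar) (h : R -> R) :
  (forall x, inI a b x -> is_derive h x 0) ->
  forall x y, inI a b x -> inI a b y -> h x = h y.
Proof.
  intros H.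
  assert (W : forall x y, x < y -> inI a b x -> inI a b y -> h x = h y).
  { intros x y L Hx Hy; destruct (mvt_on a b h (fun _ => 0) x y H Hx Hy L) as [z [E _]]; lra. }
  intros x y Hx Hy; destruct (Rtotal_order x y) as [L|[->|L]]; auto; symmetry; auto.
Qed.

Lemma antiderivative_exists (a b : Rbar) (k : R -> R) :
  Rbar_lt a b -> cont_on a b k ->
  exists h, forall x, inI a b x -> is_derive h x (k x).
Proof.
  intros Hab Hk; destruct (inI_inhabited a b Hab) as [x0 H0].
  exists (fun x => RInt k x0 x); intros x Hx.
  apply (is_derive_RInt (V := R_CompleteNormedModule) k (fun x => RInt k x0 x) x0 x); [|apply Hk, Hx].
  apply (filter_imp (inI a b)); [|apply inI_locally, Hx].
  intros y Hy; apply (RInt_correct (V := R_CompleteNormedModule)).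
  apply (ex_RInt_continuous (V := R_CompleteNormedModule)); intros z Hz; apply Hk.
  unfold Rmin, Rmax in Hz; destruct (Rle_dec x0 y);
    [apply (inI_convex a b x0 y)|apply (inI_convex a b y x0)]; auto.
Qed.

Lemma strict_mono_on_inj (a b : Rbar) (h : R -> R) (x y : R) :
  strict_mono_on a b h -> inI a b x -> inI a b y -> h x = h y -> x = y.
Proof.
  intros [H|H] Hx Hy E; destruct (Rtotal_order x y) as [L|[L|L]]; auto;
    [assert (T := H x y Hx Hy L)|assert (T := H y x Hy Hx L)
    |assert (T := H x y Hx Hy L)|assert (T := H y x Hy Hx L)]; lra.
Qed.

Lemma strict_mono_on_between (a b : Rbar) (h : R -> R) (x s y : R) :
  strict_mono_on a b h -> inI a b x -> inI a b y -> x <= s <= y ->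
  Rmin (h x) (h y) <= h s <= Rmax (h x) (h y).
Proof.
  intros M Hx Hy Hs; assert (Is := inI_convex a b x y s Hx Hy Hs).
  destruct Hs as [[L1| ->] [L2| ->]]; unfold Rmin, Rmax;
    match goal with |- context [Rle_dec ?u ?v] => destruct (Rle_dec u v) end; try lra;
    destruct M as [M|M]; assert (T1 := M x s Hx Is L1); assert (T2 := M s y Is Hy L2); lra.
Qed.

Lemma inv_on_eq (a b : Rbar) (h : R -> R) (z y : R) :
  strict_mono_on a b h -> inI a b z -> h z = y -> inv_on a b h y = z.
Proof.
  intros Hm Hz E; unfold inv_on.
  assert (S := epsilon_spec (inhabits 0) (fun z => inI a b z /\ h z = y)
    (ex_intro _ z (conj Hz E))); destruct S as [S1 S2].
  apply (strict_mono_on_inj a b h); auto; lra.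
Qed.

Lemma qa_mean_spec (a b : Rbar) (h : R -> R) (x y : R) :
  cont_on a b h -> inI a b x -> inI a b y ->
  inI a b (qa_mean a b h x y) /\ h (qa_mean a b h x y) = (h x + h y) / 2.
Proof.
  intros Hh Hx Hy; unfold qa_mean, inv_on.
  apply (epsilon_spec (inhabits 0) (fun z => inI a b z /\ h z = (h x + h y) / 2)).
  apply (cont_on_ivt a b h x y); auto.
  unfold Rmin, Rmax; destruct (Rle_dec (h x) (h y)); lra.
Qed.

Lemma qa_mean_eq (a b : Rbar) (h : R -> R) (x y m : R) :
  strict_mono_on a b h -> inI a b m -> h x + h y = 2 * h m -> qa_mean a b h x y = m.
Proof.
  intros Hm Hi E; apply inv_on_eq; auto; lra.
Qed.

(** * Conics *)

Definition quad (al be ga de ep et u v : R) : R :=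
  al * u ^ 2 + be * u * v + ga * v ^ 2 + de * u + ep * v + et.

Definition is_conic (Q : R -> R -> R) : Prop :=
  exists al be ga de ep et, ~ (al = 0 /\ be = 0 /\ ga = 0) /\
    forall u v, Q u v = quad al be ga de ep et u v.

(** Twice the signed area of the triangle, so it vanishes exactly for collinear points. *)
Definition det3 (u0 v0 u1 v1 u2 v2 : R) : R :=
  (u1 - u0) * (v2 - v0) - (u2 - u0) * (v1 - v0).

(** Three zeros on the axis [v = 0] kill the terms without [v], and the zero at [(0, 1)] leaves
    [v * (be * u + ga * (v - 1))]. The last hypothesis, that [(0, 1)], [(x3, y3)], [(x4, y4)] are
    not collinear, is the determinant of the remaining linear system for [be] and [ga]. *)
Lemma quad_zero_normalized (al be ga de ep et x3 y3 x4 y4 : R) :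
  quad al be ga de ep et 0 0 = 0 -> quad al be ga de ep et 1 0 = 0 ->
  quad al be ga de ep et (1 / 2) 0 = 0 -> quad al be ga de ep et 0 1 = 0 ->
  quad al be ga de ep et x3 y3 = 0 -> quad al be ga de ep et x4 y4 = 0 ->
  y3 <> 0 -> y4 <> 0 -> x3 * (y4 - 1) - x4 * (y3 - 1) <> 0 ->
  forall u v, quad al be ga de ep et u v = 0.
Proof.
  unfold quad; intros H0 H1 Hh H2 H3 H4 N3 N4 N u v.
  assert (et = 0) by lra; assert (al = 0) by lra; assert (de = 0) by lra.
  assert (ep = - ga) by lra; subst.
  assert (E3 : be * x3 + ga * (y3 - 1) = 0) by (apply (Rmult_eq_reg_l y3); [lra|auto]).
  assert (E4 : be * x4 + ga * (y4 - 1) = 0) by (apply (Rmult_eq_reg_l y4); [lra|auto]).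
  assert (be = 0).
  { apply (Rmult_eq_reg_l (x3 * (y4 - 1) - x4 * (y3 - 1))); auto.
    replace ((x3 * (y4 - 1) - x4 * (y3 - 1)) * be)
      with ((y4 - 1) * (be * x3 + ga * (y3 - 1)) - (y3 - 1) * (be * x4 + ga * (y4 - 1))) by ring.
    rewrite E3, E4; ring. }
  assert (ga = 0).
  { apply (Rmult_eq_reg_l (x3 * (y4 - 1) - x4 * (y3 - 1))); auto.
    replace ((x3 * (y4 - 1) - x4 * (y3 - 1)) * ga)
      with (x3 * (be * x4 + ga * (y4 - 1)) - x4 * (be * x3 + ga * (y3 - 1))) by ring.
    rewrite E3, E4; ring. }
  subst; ring.
Qed.

(* In the affine frame (P0; P1 - P0, P2 - P0) the polynomial vanishes on the line P0 P1,
   so the other factor is affine and vanishes at the three points P2, P3, P4. *)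
Lemma quad_zero_of_points (al be ga de ep et : R) (u v : nat -> R) :
  (forall i, (i <= 4)%nat -> quad al be ga de ep et (u i) (v i) = 0) ->
  quad al be ga de ep et ((u 0%nat + u 1%nat) / 2) ((v 0%nat + v 1%nat) / 2) = 0 ->
  (forall i j k, (i < j)%nat -> (j < k)%nat -> (k <= 4)%nat ->
     det3 (u i) (v i) (u j) (v j) (u k) (v k) <> 0) ->
  forall x y, quad al be ga de ep et x y = 0.
Proof.
  intros Hz Hh Hd.
  assert (Z0 := Hz 0%nat ltac:(lia)); assert (Z1 := Hz 1%nat ltac:(lia)).
  assert (Z2 := Hz 2%nat ltac:(lia)); assert (Z3 := Hz 3%nat ltac:(lia)).
  assert (Z4 := Hz 4%nat ltac:(lia)).
  assert (D := Hd 0%nat 1%nat 2%nat ltac:(lia) ltac:(lia) ltac:(lia)).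
  assert (D3 := Hd 0%nat 1%nat 3%nat ltac:(lia) ltac:(lia) ltac:(lia)).
  assert (D4 := Hd 0%nat 1%nat 4%nat ltac:(lia) ltac:(lia) ltac:(lia)).
  assert (D5 := Hd 2%nat 3%nat 4%nat ltac:(lia) ltac:(lia) ltac:(lia)).
  clear Hz Hd; revert Z0 Z1 Z2 Z3 Z4 Hh D D3 D4 D5.
  generalize (u 0%nat) (v 0%nat) (u 1%nat) (v 1%nat) (u 2%nat) (v 2%nat)
    (u 3%nat) (v 3%nat) (u 4%nat) (v 4%nat); clear u v.
  intros u0 v0 u1 v1 u2 v2 u3 v3 u4 v4 Z0 Z1 Z2 Z3 Z4 Hh D D3 D4 D5.
  unfold det3 in *.
  set (d := (u1 - u0) * (v2 - v0) - (u2 - u0) * (v1 - v0)) in *.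
  set (X := fun s t => ((s - u0) * (v2 - v0) - (t - v0) * (u2 - u0)) / d).
  set (Y := fun s t => ((u1 - u0) * (t - v0) - (v1 - v0) * (s - u0)) / d).
  (* The new coefficients come from expanding the polynomial at [P0 + X (P1 - P0) + Y (P2 - P0)]. *)
  assert (T : exists a' b' c' d' e' f', forall s t,
    quad al be ga de ep et s t = quad a' b' c' d' e' f' (X s t) (Y s t)).
  { exists (al * (u1 - u0) ^ 2 + be * (u1 - u0) * (v1 - v0) + ga * (v1 - v0) ^ 2),
      (2 * al * (u1 - u0) * (u2 - u0) + be * ((u1 - u0) * (v2 - v0) + (u2 - u0) * (v1 - v0))
         + 2 * ga * (v1 - v0) * (v2 - v0)),
      (al * (u2 - u0) ^ 2 + be * (u2 - u0) * (v2 - v0) + ga * (v2 - v0) ^ 2),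
      (2 * al * u0 * (u1 - u0) + be * (u0 * (v1 - v0) + v0 * (u1 - u0))
         + 2 * ga * v0 * (v1 - v0) + de * (u1 - u0) + ep * (v1 - v0)),
      (2 * al * u0 * (u2 - u0) + be * (u0 * (v2 - v0) + v0 * (u2 - u0))
         + 2 * ga * v0 * (v2 - v0) + de * (u2 - u0) + ep * (v2 - v0)),
      (quad al be ga de ep et u0 v0).
    intros s t.
    assert (Es : s = u0 + X s t * (u1 - u0) + Y s t * (u2 - u0)).
    { unfold X, Y; apply (Rmult_eq_reg_r d); auto. unfold d; field; exact D. }
    assert (Et : t = v0 + X s t * (v1 - v0) + Y s t * (v2 - v0)).
    { unfold X, Y; apply (Rmult_eq_reg_r d); auto. unfold d; field; exact D. }
    revert Es Et; generalize (X s t) (Y s t); intros x y -> ->; unfold quad; ring. }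
  destruct T as (a' & b' & c' & d' & e' & f' & T).
  intros s t; rewrite T; rewrite T in Z0, Z1, Z2, Z3, Z4, Hh.
  apply (quad_zero_normalized a' b' c' d' e' f' (X u3 v3) (Y u3 v3) (X u4 v4) (Y u4 v4)).
  - refine (eq_trans _ Z0); f_equal; unfold X, Y; field; auto.
  - refine (eq_trans _ Z1); f_equal; unfold X, Y, d; field; auto.
  - refine (eq_trans _ Hh); f_equal; unfold X, Y, d; field; auto.
  - refine (eq_trans _ Z2); f_equal; unfold X, Y, d; field; auto.
  - exact Z3.
  - exact Z4.
  - unfold Y; intros E; apply D3.
    transitivity (((u1 - u0) * (v3 - v0) - (v1 - v0) * (u3 - u0)) / d * d); [field; auto|].
    rewrite E; ring.
  - unfold Y; intros E; apply D4.
    transitivity (((u1 - u0) * (v4 - v0) - (v1 - v0) * (u4 - u0)) / d * d); [field; auto|].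
    rewrite E; ring.
  - intros E; apply D5.
    transitivity ((X u3 v3 * (Y u4 v4 - 1) - X u4 v4 * (Y u3 v3 - 1)) * d).
    + unfold X, Y, d; field; exact D.
    + rewrite E; ring.
Qed.

Lemma quad_linear (k1 k2 a1 b1 c1 d1 e1 f1 a2 b2 c2 d2 e2 f2 u v : R) :
  quad (k1 * a1 - k2 * a2) (k1 * b1 - k2 * b2) (k1 * c1 - k2 * c2) (k1 * d1 - k2 * d2)
    (k1 * e1 - k2 * e2) (k1 * f1 - k2 * f2) u v =
  k1 * quad a1 b1 c1 d1 e1 f1 u v - k2 * quad a2 b2 c2 d2 e2 f2 u v.
Proof. unfold quad; ring. Qed.

Lemma conic_not_identically_zero (al be ga de ep et : R) :
  (forall u v, quad al be ga de ep et u v = 0) -> al = 0 /\ be = 0 /\ ga = 0.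
Proof.
  unfold quad; intros H.
  assert (A := H 0 0); assert (B := H 1 0); assert (C := H (-1) 0);
  assert (D := H 0 1); assert (E := H 0 (-1)); assert (F := H 1 1).
  repeat split; lra.
Qed.

(** Five points leave one degree of freedom, and the midpoint of the first two fixes it. Neither
    polynomial vanishes there, since it would then be identically zero; the combination that cancels
    at the midpoint has six zeros, so the two polynomials are proportional. *)
Lemma conic_unique (Q1 Q2 : R -> R -> R) (u v : nat -> R) :
  is_conic Q1 -> is_conic Q2 ->
  (forall i, (i <= 4)%nat -> Q1 (u i) (v i) = 0 /\ Q2 (u i) (v i) = 0) ->
  (forall i j k, (i < j)%nat -> (j < k)%nat -> (k <= 4)%nat ->
     det3 (u i) (v i) (u j) (v j) (u k) (v k) <> 0) ->
  forall x y, Q2 x y = 0 -> Q1 x y = 0.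
Proof.
  intros (a1 & b1 & c1 & d1 & e1 & f1 & N1 & E1) (a2 & b2 & c2 & d2 & e2 & f2 & N2 & E2)
    Hz Hd x y.
  rewrite E1, E2.
  set (mu := (u 0%nat + u 1%nat) / 2); set (mv := (v 0%nat + v 1%nat) / 2).
  assert (K1 : quad a1 b1 c1 d1 e1 f1 mu mv <> 0).
  { intros K; apply N1, (conic_not_identically_zero a1 b1 c1 d1 e1 f1).
    apply (quad_zero_of_points _ _ _ _ _ _ u v); auto.
    intros i Hi; rewrite <- E1; apply Hz; auto. }
  assert (K2 : quad a2 b2 c2 d2 e2 f2 mu mv <> 0).
  { intros K; apply N2, (conic_not_identically_zero a2 b2 c2 d2 e2 f2).
    apply (quad_zero_of_points _ _ _ _ _ _ u v); auto.
    intros i Hi; rewrite <- E2; apply Hz; auto. }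
  set (k2 := quad a1 b1 c1 d1 e1 f1 mu mv) in *.
  set (k1 := quad a2 b2 c2 d2 e2 f2 mu mv) in *.
  assert (Z : forall s t, k1 * quad a1 b1 c1 d1 e1 f1 s t - k2 * quad a2 b2 c2 d2 e2 f2 s t = 0).
  { intros s t; rewrite <- quad_linear.
    apply (quad_zero_of_points _ _ _ _ _ _ u v); auto.
    - intros i Hi; rewrite quad_linear, <- E1, <- E2.
      destruct (Hz i Hi) as [-> ->]; ring.
    - rewrite quad_linear; fold mu mv k1 k2; ring. }
  intros H; specialize (Z x y); rewrite H in Z.
  apply (Rmult_eq_reg_l k1); auto; lra.
Qed.

(* In the basis of the first two steps the recurrence reads P(k+1) = (1 - Y, X + c Y), which
   preserves X^2 + c X Y + Y^2 - X - (1 + c) Y. *)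
Lemma recurrence_conic (N : nat) (c : R) (u v : nat -> R) :
  (forall k, (k + 3 <= N)%nat ->
    u (S (S (S k))) - u (S (S k)) + (u (S k) - u k) = c * (u (S (S k)) - u (S k)) /\
    v (S (S (S k))) - v (S (S k)) + (v (S k) - v k) = c * (v (S (S k)) - v (S k))) ->
  det3 (u 0%nat) (v 0%nat) (u 1%nat) (v 1%nat) (u 2%nat) (v 2%nat) <> 0 ->
  exists Q, is_conic Q /\ forall k, (k <= N)%nat -> Q (u k) (v k) = 0.
Proof.
  intros Hr D.
  set (a0 := u 1%nat - u 0%nat); set (b0 := v 1%nat - v 0%nat).
  set (a1 := u 2%nat - u 1%nat); set (b1 := v 2%nat - v 1%nat).
  set (d := a0 * b1 - a1 * b0).
  assert (Hd : d <> 0) by (unfold d, a0, a1, b0, b1; unfold det3 in D; lra).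
  set (X := fun s t => ((s - u 0%nat) * b1 - (t - v 0%nat) * a1) / d).
  set (Y := fun s t => ((t - v 0%nat) * a0 - (s - u 0%nat) * b0) / d).
  set (Q := fun s t => X s t ^ 2 + c * X s t * Y s t + Y s t ^ 2 - X s t - (1 + c) * Y s t).
  exists Q; split.
  - set (p1 := b1 / d); set (p2 := - a1 / d); set (q1 := - b0 / d); set (q2 := a0 / d).
    set (p0 := - (p1 * u 0%nat + p2 * v 0%nat)); set (q0 := - (q1 * u 0%nat + q2 * v 0%nat)).
    exists (p1 ^ 2 + c * p1 * q1 + q1 ^ 2),
      (2 * p1 * p2 + c * (p1 * q2 + p2 * q1) + 2 * q1 * q2),
      (p2 ^ 2 + c * p2 * q2 + q2 ^ 2),
      (2 * p0 * p1 + c * (p0 * q1 + p1 * q0) + 2 * q0 * q1 - p1 - (1 + c) * q1),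
      (2 * p0 * p2 + c * (p0 * q2 + p2 * q0) + 2 * q0 * q2 - p2 - (1 + c) * q2),
      (p0 ^ 2 + c * p0 * q0 + q0 ^ 2 - p0 - (1 + c) * q0).
    split.
    + intros (A & B & C).
      (* The leading form takes the value [1] on the first step [(a0, b0)], whose coordinates in the
         basis of steps are [(1, 0)]; so its coefficients do not all vanish. *)
      assert (E : (p1 ^ 2 + c * p1 * q1 + q1 ^ 2) * a0 ^ 2
        + (2 * p1 * p2 + c * (p1 * q2 + p2 * q1) + 2 * q1 * q2) * a0 * b0
        + (p2 ^ 2 + c * p2 * q2 + q2 ^ 2) * b0 ^ 2 = 1).
      { transitivity ((p1 * a0 + p2 * b0) ^ 2 + c * (p1 * a0 + p2 * b0) * (q1 * a0 + q2 * b0)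
          + (q1 * a0 + q2 * b0) ^ 2); [ring|].
        replace (p1 * a0 + p2 * b0) with 1 by (unfold p1, p2; field_simplify; [|auto];
          unfold d; field; exact Hd).
        replace (q1 * a0 + q2 * b0) with 0 by (unfold q1, q2; field; auto). ring. }
      rewrite A, B, C in E; lra.
    + intros s t; unfold Q, quad.
      replace (X s t) with (p1 * s + p2 * t + p0) by (unfold X, p1, p2, p0, p1, p2; field; auto).
      replace (Y s t) with (q1 * s + q2 * t + q0) by (unfold Y, q1, q2, q0, q1, q2; field; auto).
      ring.
  - assert (X0 : X (u 0%nat) (v 0%nat) = 0) by (unfold X; field; auto).
    assert (Y0 : Y (u 0%nat) (v 0%nat) = 0) by (unfold Y; field; auto).
    assert (X1 : X (u 1%nat) (v 1%nat) = 1)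
      by (unfold X; fold a0 b0; unfold d; field; exact Hd).
    assert (Y1 : Y (u 1%nat) (v 1%nat) = 0) by (unfold Y; fold a0 b0; field; auto).
    assert (X2 : X (u 2%nat) (v 2%nat) = 1).
    { unfold X; replace (u 2%nat - u 0%nat) with (a0 + a1) by (unfold a0, a1; ring).
      replace (v 2%nat - v 0%nat) with (b0 + b1) by (unfold b0, b1; ring).
      unfold d; field; exact Hd. }
    assert (Y2 : Y (u 2%nat) (v 2%nat) = 1).
    { unfold Y; replace (u 2%nat - u 0%nat) with (a0 + a1) by (unfold a0, a1; ring).
      replace (v 2%nat - v 0%nat) with (b0 + b1) by (unfold b0, b1; ring).
      unfold d; field; exact Hd. }
    set (x := fun k => X (u k) (v k)); set (y := fun k => Y (u k) (v k)).
    assert (Rx : forall k, (k + 3 <= N)%nat ->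
      x (S (S (S k))) - x (S (S k)) + (x (S k) - x k) = c * (x (S (S k)) - x (S k)) /\
      y (S (S (S k))) - y (S (S k)) + (y (S k) - y k) = c * (y (S (S k)) - y (S k))).
    { intros k Hk; destruct (Hr k Hk) as [R1 R2]; unfold x, y, X, Y; split.
      - apply Rminus_diag_uniq.
        transitivity (((u (S (S (S k))) - u (S (S k)) + (u (S k) - u k)
           - c * (u (S (S k)) - u (S k))) * b1
         - (v (S (S (S k))) - v (S (S k)) + (v (S k) - v k)
           - c * (v (S (S k)) - v (S k))) * a1) / d); [field; auto|].
        rewrite R1, R2; field; auto.
      - apply Rminus_diag_uniq.
        transitivity (((v (S (S (S k))) - v (S (S k)) + (v (S k) - v k)
           - c * (v (S (S k)) - v (S k))) * a0
         - (u (S (S (S k))) - u (S (S k)) + (u (S k) - u k)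
           - c * (u (S (S k)) - u (S k))) * b0) / d); [field; auto|].
        rewrite R1, R2; field; auto. }
    (* The recurrence links four consecutive points, so the induction has to carry the affine map
       for two consecutive indices. *)
    assert (St : forall k, (S (S k) <= N)%nat ->
      (x (S k) = 1 - y k /\ y (S k) = x k + c * y k) /\
      (x (S (S k)) = 1 - y (S k) /\ y (S (S k)) = x (S k) + c * y (S k))).
    { induction k as [|k IH]; intros Hk.
      - unfold x, y; rewrite X0, X1, X2, Y0, Y1, Y2; repeat split; ring.
      - destruct (IH ltac:(lia)) as [[A1 A2] [A3 A4]]; destruct (Rx k ltac:(lia)) as [B1 B2].
        split; [split; auto|].
        split; [|rewrite A3 in B1 |- *]; rewrite ?A4, ?A3, ?A2, ?A1 in *; lra. }
    assert (QS : forall k, (k <= N)%nat ->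
      x k ^ 2 + c * x k * y k + y k ^ 2 - x k - (1 + c) * y k = 0).
    { induction k as [|k IH]; intros Hk.
      - unfold x, y; rewrite X0, Y0; ring.
      - specialize (IH ltac:(lia)).
        assert (E : x (S k) = 1 - y k /\ y (S k) = x k + c * y k).
        { destruct k as [|k].
          - unfold x, y; rewrite X0, X1, Y0, Y1; split; ring.
          - apply (St k); lia. }
        destruct E as [-> ->]; rewrite <- IH; ring. }
    exact QS.
Qed.

(** * The Cauchy mean *)

Lemma Cn_on_derive (n : nat) (a b : Rbar) (f : R -> R) (k : nat) (x : R) :
  Cn_on n a b f -> (k < n)%nat -> inI a b x ->
  is_derive (Derive_n f k) x (Derive_n f (S k) x).
Proof. intros [H _] Hk Hx; apply Derive_correct, H; auto. Qed.

Lemma Cn_on_continuous (n : nat) (a b : Rbar) (f : R -> R) (k : nat) :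
  Cn_on n a b f -> (k <= n)%nat -> cont_on a b (Derive_n f k).
Proof.
  intros [H C] Hk x Hx; destruct (Nat.eq_dec k n) as [->|]; auto.
  apply (ex_derive_continuous (V := R_NormedModule)), H; auto; lia.
Qed.

Lemma Cn_on_le (m n : nat) (a b : Rbar) (f : R -> R) :
  (m <= n)%nat -> Cn_on n a b f -> Cn_on m a b f.
Proof.
  intros L H; split.
  - intros k x Hk Hx; apply H; auto; lia.
  - intros x Hx; apply (Cn_on_continuous n a b f m H); auto.
Qed.

Lemma C1_facts (a b : Rbar) (f g : R -> R) : class_C1 a b f g ->
  (forall x, inI a b x -> is_derive f x (Derive f x)) /\
  (forall x, inI a b x -> is_derive g x (Derive g x)) /\
  cont_on a b (Derive f) /\ cont_on a b (Derive g) /\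
  cont_on a b (fun t => Derive f t / Derive g t) /\ strict_mono_on a b g.
Proof.
  intros (Hf & Hg & Hn & Hm).
  assert (Df := fun x => Cn_on_derive 1 a b f 0 x Hf Nat.lt_0_1); simpl in Df.
  assert (Dg := fun x => Cn_on_derive 1 a b g 0 x Hg Nat.lt_0_1); simpl in Dg.
  assert (Cf : cont_on a b (Derive f)) by exact (proj2 Hf).
  assert (Cg : cont_on a b (Derive g)) by exact (proj2 Hg).
  split; [exact Df|split; [exact Dg|split; [exact Cf|split; [exact Cg|split]]]].
  - intros x Hx; apply (continuous_mult (Derive f) (fun t => / Derive g t)); [apply Cf, Hx|].
    apply continuous_Rinv_comp; auto.
  - apply (strict_mono_derive a b g (Derive g)); auto.
Qed.

Lemma C1_g_neq (a b : Rbar) (f g : R -> R) (x y : R) : class_C1 a b f g ->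
  inI a b x -> inI a b y -> x <> y -> g x - g y <> 0.
Proof.
  intros H Hx Hy N E; apply N, (strict_mono_on_inj a b g); auto; [|lra].
  apply (C1_facts a b f g H).
Qed.

Lemma cauchy_mean_eq (a b : Rbar) (f g : R -> R) (x y m : R) : class_C1 a b f g ->
  inI a b x -> inI a b y -> inI a b m -> x <> y ->
  f x - f y = Derive f m / Derive g m * (g x - g y) -> cauchy_mean a b f g x y = m.
Proof.
  intros H Hx Hy Hm N E; unfold cauchy_mean; destruct (Req_EM_T x y) as [|_]; [tauto|].
  apply inv_on_eq; auto; [apply H|].
  assert (Ng := C1_g_neq a b f g x y H Hx Hy N); rewrite E; field; split; auto.
  apply H; auto.
Qed.

Lemma cauchy_mean_diag (a b : Rbar) (f g : R -> R) (x : R) : cauchy_mean a b f g x x = x.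
Proof. unfold cauchy_mean; destruct (Req_EM_T x x); tauto. Qed.

Lemma cauchy_mvt (a b : Rbar) (f g : R -> R) (x y : R) : class_C1 a b f g ->
  inI a b x -> inI a b y -> x < y ->
  exists m, inI a b m /\ x < m < y /\
    f x - f y = Derive f m / Derive g m * (g x - g y).
Proof.
  intros H Hx Hy L; destruct (C1_facts a b f g H) as (Df & Dg & _).
  assert (D : forall t, inI a b t -> is_derive (fun t => f t * (g x - g y) - g t * (f x - f y)) t
    (Derive f t * (g x - g y) - Derive g t * (f x - f y))).
  { intros t Ht; assert (A := Df t Ht); assert (B := Dg t Ht).
    solve_derive; ring. }
  destruct (mvt_on a b _ _ x y D Hx Hy L) as [m [E Hm]].
  assert (Im : inI a b m) by (apply (inI_convex a b x y); auto; lra).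
  exists m; split; [exact Im|split; [exact Hm|]].
  assert (Z : Derive f m * (g x - g y) - Derive g m * (f x - f y) = 0).
  { apply (Rmult_eq_reg_r (y - x)); [|lra]; rewrite <- E; ring. }
  assert (Nz : Derive g m <> 0) by (apply H; auto).
  apply (Rmult_eq_reg_l (Derive g m)); auto.
  transitivity (Derive f m * (g x - g y)); [lra|field; auto].
Qed.

Lemma cauchy_mean_between (a b : Rbar) (f g : R -> R) (x y : R) : class_C1 a b f g ->
  inI a b x -> inI a b y -> x < y -> x < cauchy_mean a b f g x y < y.
Proof.
  intros H Hx Hy L; destruct (cauchy_mvt a b f g x y H Hx Hy L) as (m & Im & Hm & E).
  rewrite (cauchy_mean_eq a b f g x y m); auto; lra.
Qed.

Lemma cauchy_mean_sym (a b : Rbar) (f g : R -> R) (x y : R) : class_C1 a b f g ->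
  inI a b x -> inI a b y -> cauchy_mean a b f g x y = cauchy_mean a b f g y x.
Proof.
  intros H Hx Hy; unfold cauchy_mean.
  destruct (Req_EM_T x y) as [E|N]; destruct (Req_EM_T y x) as [|N']; try tauto; try congruence.
  assert (N1 := C1_g_neq a b f g x y H Hx Hy N); assert (N2 := C1_g_neq a b f g y x H Hy Hx N').
  f_equal; field; auto.
Qed.

Lemma cauchy_mean_in (a b : Rbar) (f g : R -> R) (x y : R) : class_C1 a b f g ->
  inI a b x -> inI a b y -> inI a b (cauchy_mean a b f g x y).
Proof.
  intros H Hx Hy; destruct (Rtotal_order x y) as [L|[->|L]].
  - apply (inI_convex a b x y); auto; assert (T := cauchy_mean_between a b f g x y H Hx Hy L); lra.
  - rewrite cauchy_mean_diag; auto.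
  - rewrite cauchy_mean_sym; auto; apply (inI_convex a b y x); auto.
    assert (T := cauchy_mean_between a b f g y x H Hy Hx L); lra.
Qed.

(** The chord is parallel to the tangent at the mean. With the denominator cleared, the identity
    also covers [x = y]. *)
Lemma cauchy_mean_chord (a b : Rbar) (f g : R -> R) (x y : R) : class_C1 a b f g ->
  inI a b x -> inI a b y ->
  f x - f y = Derive f (cauchy_mean a b f g x y) / Derive g (cauchy_mean a b f g x y) * (g x - g y).
Proof.
  intros H.
  assert (L : forall x y, inI a b x -> inI a b y -> x < y -> f x - f y =
    Derive f (cauchy_mean a b f g x y) / Derive g (cauchy_mean a b f g x y) * (g x - g y)).
  { clear x y; intros x y Hx Hy L; destruct (cauchy_mvt a b f g x y H Hx Hy L) as (m & Im & Hm & E).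
    rewrite (cauchy_mean_eq a b f g x y m); auto; lra. }
  intros Hx Hy; destruct (Rtotal_order x y) as [Lt|[->|Lt]]; auto; [ring|].
  rewrite (cauchy_mean_sym a b f g x y); auto.
  assert (E := L y x Hy Hx Lt); lra.
Qed.

(** * Grids of a bisymmetric mean *)

(** The model is an arithmetic progression in the variable h of a quasiarithmetic mean, expressed
    without mentioning h. *)
Definition is_grid (M : R -> R -> R) (N : nat) (x : nat -> R) : Prop :=
  forall i j i' j', (i <= N)%nat -> (j <= N)%nat -> (i' <= N)%nat -> (j' <= N)%nat ->
    (i + j = i' + j')%nat -> M (x i) (x j) = M (x i') (x j').

(** The two indices are the halves of [k] rounded down and up: for an idempotent mean, even indices
    keep the old points and odd ones insert the mean of two neighbours. *)
Definition refine_grid (M : R -> R -> R) (x : nat -> R) (k : nat) : R :=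
  M (x (Nat.div2 k)) (x (Nat.div2 (S k))).

Fixpoint dyadic (M : R -> R -> R) (A B : R) (n : nat) : nat -> R :=
  match n with
  | O => fun k => match k with O => A | _ => B end
  | S n => refine_grid M (dyadic M A B n)
  end.

Lemma div2_even (i : nat) : Nat.div2 (2 * i) = i.
Proof. apply Nat.div2_double. Qed.

Lemma div2_odd (i : nat) : Nat.div2 (S (2 * i)) = i.
Proof. apply Nat.div2_succ_double. Qed.

(** By the grid property, the new point of index [i + j] is the mean of [x i] and [x j] for every
    splitting of the index. Bisymmetry then regroups the mean of two new points until their indices
    are the two halves of [k + l], a form that depends on the sum alone. *)
Lemma grid_refine (M : R -> R -> R) (P : R -> Prop) (N : nat) (x : nat -> R) :
  (forall s, M s s = s) -> (forall s t, P s -> P t -> M s t = M t s) ->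
  (forall s t, P s -> P t -> P (M s t)) ->
  (forall s t u v, P s -> P t -> P u -> P v -> M (M s t) (M u v) = M (M s u) (M t v)) ->
  (forall i, (i <= N)%nat -> P (x i)) -> is_grid M N x -> is_grid M (2 * N) (refine_grid M x).
Proof.
  intros Md Ms Mi Mb HP Hg.
  set (y := refine_grid M x).
  assert (Ev : forall i, y (2 * i)%nat = x i).
  { intros i; unfold y, refine_grid; rewrite div2_even, div2_odd; apply Md. }
  assert (A : forall i j, (i <= N)%nat -> (j <= N)%nat -> y (i + j)%nat = M (x i) (x j)).
  { intros i j Hi Hj; unfold y, refine_grid.
    destruct (Nat.Even_or_Odd (i + j)) as [[s Hs]|[s Hs]].
    - rewrite Hs, div2_even, div2_odd; apply Hg; lia.
    - rewrite Hs; replace (S (2 * s + 1)) with (2 * (s + 1))%nat by lia.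
      replace (2 * s + 1)%nat with (S (2 * s)) by lia.
      rewrite div2_even, div2_odd; apply Hg; lia. }
  assert (Hy : forall k, (k <= 2 * N)%nat -> P (y k)).
  { intros k Hk; destruct (Nat.Even_or_Odd k) as [[s Hs]|[s Hs]].
    - replace k with (s + s)%nat by lia; rewrite A by lia; apply Mi; apply HP; lia.
    - replace k with (s + (s + 1))%nat by lia; rewrite A by lia; apply Mi; apply HP; lia. }
  assert (T : forall k l, (k <= 2 * N)%nat -> (l <= 2 * N)%nat ->
    M (y k) (y l) = M (y (Nat.div2 (k + l))) (y (Nat.div2 (S (k + l))))).
  { assert (EO : forall i p, (i <= N)%nat -> (p + 1 <= N)%nat ->
      M (y (2 * i)%nat) (y (2 * p + 1)%nat) = M (y (i + p)%nat) (y (i + p + 1)%nat)).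
    (* Idempotence turns [x i] into a mean of two points, so that bisymmetry applies. *)
    { intros i p Hi Hp; rewrite Ev, <- (Md (x i)).
      replace (2 * p + 1)%nat with (p + (p + 1))%nat by lia.
      replace (i + p + 1)%nat with (i + (p + 1))%nat by lia.
      rewrite !A by lia; apply Mb; apply HP; lia. }
    intros k l Hk Hl.
    destruct (Nat.Even_or_Odd k) as [[i Hi]|[i Hi]], (Nat.Even_or_Odd l) as [[p Hp]|[p Hp]].
    - replace (k + l)%nat with (2 * (i + p))%nat by lia; rewrite div2_even, div2_odd, Md.
      rewrite Hi, Hp, !Ev; symmetry; apply A; lia.
    - replace (S (k + l)) with (2 * (i + p + 1))%nat by lia.
      replace (k + l)%nat with (S (2 * (i + p))) by lia; rewrite div2_even, div2_odd.
      rewrite Hi, Hp; apply EO; lia.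
    - replace (S (k + l)) with (2 * (i + p + 1))%nat by lia.
      replace (k + l)%nat with (S (2 * (i + p))) by lia; rewrite div2_even, div2_odd.
      rewrite Ms by (apply Hy; auto); rewrite (Nat.add_comm i p).
      rewrite Hi, Hp; apply EO; lia.
    - replace (k + l)%nat with (2 * (i + p + 1))%nat by lia; rewrite div2_even, div2_odd, Md.
      rewrite Hi, Hp; replace (2 * i + 1)%nat with (i + (i + 1))%nat by lia.
      (* The reversed order of [p] and [p + 1] gives both regrouped means the same index sum
         [i + p + 1]. *)
      replace (2 * p + 1)%nat with ((p + 1) + p)%nat by lia.
      rewrite !A by lia; rewrite Mb by (apply HP; lia).
      rewrite <- !A by lia; replace (i + 1 + p)%nat with (i + (p + 1))%nat by lia.
      rewrite Md; f_equal; lia. }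
  intros i j i' j' Hi Hj Hi' Hj' E; rewrite T by auto; rewrite (T i' j') by auto; rewrite E; auto.
Qed.

Lemma refine_grid_mono (M : R -> R -> R) (P : R -> Prop) (N : nat) (x : nat -> R) :
  (forall s, M s s = s) -> (forall s t, P s -> P t -> s < t -> s < M s t < t) ->
  (forall i, (i <= N)%nat -> P (x i)) ->
  (forall i, (i < N)%nat -> x i < x (S i)) ->
  forall k, (k < 2 * N)%nat -> refine_grid M x k < refine_grid M x (S k).
Proof.
  intros Md Mb HP Hx k Hk; unfold refine_grid.
  destruct (Nat.Even_or_Odd k) as [[s Hs]|[s Hs]].
  - rewrite Hs; replace (S (S (2 * s))) with (2 * S s)%nat by lia.
    rewrite !div2_even, !div2_odd, Md; apply Mb; [apply HP|apply HP|apply Hx]; lia.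
  - rewrite Hs; replace (2 * s + 1)%nat with (S (2 * s)) by lia.
    replace (S (S (2 * s))) with (2 * S s)%nat by lia.
    rewrite !div2_even, !div2_odd, Md; apply Mb; [apply HP|apply HP|apply Hx]; lia.
Qed.

Lemma grid_mono_lt (N : nat) (x : nat -> R) : (forall i, (i < N)%nat -> x i < x (S i)) ->
  forall i j, (i < j)%nat -> (j <= N)%nat -> x i < x j.
Proof.
  intros H i j L; induction L; intros Hj; [apply H; lia|].
  apply (Rlt_trans _ (x m)); [apply IHL; lia|apply H; lia].
Qed.

Lemma dyadic_double (M : R -> R -> R) (A B : R) (n k : nat) :
  (forall s, M s s = s) -> dyadic M A B (S n) (2 * k) = dyadic M A B n k.
Proof.
  intros Md; simpl; unfold refine_grid.
  change (k + (k + 0))%nat with (2 * k)%nat; rewrite div2_even, div2_odd; apply Md.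
Qed.

Lemma dyadic_scale (M : R -> R -> R) (A B : R) (n m k : nat) :
  (forall s, M s s = s) -> dyadic M A B (m + n) (2 ^ m * k) = dyadic M A B n k.
Proof.
  intros Md; induction m as [|m IH].
  - simpl; rewrite Nat.add_0_r; auto.
  - replace (2 ^ S m * k)%nat with (2 * (2 ^ m * k))%nat by (simpl; lia).
    change (S m + n)%nat with (S (m + n)); rewrite dyadic_double; auto.
Qed.

(** The mean of [x, y] and that of [y, z] are separated by [y], so the two chords have distinct
    values of [f'/g'] as slopes. *)
Lemma cauchy_points_not_collinear (a b : Rbar) (f g : R -> R) (x y z : R) : class_C1 a b f g ->
  inI a b x -> inI a b z -> x < y < z -> det3 (f x) (g x) (f y) (g y) (f z) (g z) <> 0.
Proof.
  intros H Hx Hz L; assert (Hy : inI a b y) by (apply (inI_convex a b x z); auto; lra).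
  assert (L1 := cauchy_mean_between a b f g x y H Hx Hy (proj1 L)).
  assert (L2 := cauchy_mean_between a b f g y z H Hy Hz (proj2 L)).
  assert (E1 := cauchy_mean_chord a b f g x y H Hx Hy).
  assert (E2 := cauchy_mean_chord a b f g y z H Hy Hz).
  assert (I1 := cauchy_mean_in a b f g x y H Hx Hy).
  assert (I2 := cauchy_mean_in a b f g y z H Hy Hz).
  set (m1 := cauchy_mean a b f g x y) in *; set (m2 := cauchy_mean a b f g y z) in *.
  assert (N : Derive f m1 / Derive g m1 <> Derive f m2 / Derive g m2).
  { intros E; assert (m1 = m2); [|lra].
    destruct H as (_ & _ & _ & Hm); exact (strict_mono_on_inj _ _ _ m1 m2 Hm I1 I2 E). }
  set (p1 := Derive f m1 / Derive g m1) in *; set (p2 := Derive f m2 / Derive g m2) in *.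
  assert (G1 : g x - g y <> 0) by (apply (C1_g_neq a b f g x y H Hx Hy); lra).
  assert (G2 : g y - g z <> 0) by (apply (C1_g_neq a b f g y z H Hy Hz); lra).
  unfold det3; intros E.
  assert (Z : (g x - g y) * (g y - g z) * (p1 - p2) = 0).
  { rewrite <- E; replace (f y) with (f x - p1 * (g x - g y)) by lra.
    replace (f z) with (f x - p1 * (g x - g y) - p2 * (g y - g z)) by lra; ring. }
  apply Rmult_integral in Z; destruct Z as [Z|Z]; [apply Rmult_integral in Z; tauto|lra].
Qed.

(* Chords of the grid points with the same index sum are parallel. *)
Lemma grid_conic (a b : Rbar) (f g : R -> R) (N : nat) (x : nat -> R) : class_C1 a b f g ->
  (3 <= N)%nat -> (forall i, (i <= N)%nat -> inI a b (x i)) ->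
  (forall i, (i < N)%nat -> x i < x (S i)) -> is_grid (cauchy_mean a b f g) N x ->
  exists Q, is_conic Q /\ forall k, (k <= N)%nat -> Q (f (x k)) (g (x k)) = 0.
Proof.
  intros H HN Hi Hx Hg.
  assert (Par : forall i j i' j', (i <= N)%nat -> (j <= N)%nat -> (i' <= N)%nat -> (j' <= N)%nat ->
    (i + j = i' + j')%nat -> (f (x i) - f (x j)) * (g (x i') - g (x j')) =
      (f (x i') - f (x j')) * (g (x i) - g (x j))).
  { intros i j i' j' L1 L2 L3 L4 E.
    rewrite (cauchy_mean_chord a b f g (x i) (x j)) by auto.
    rewrite (cauchy_mean_chord a b f g (x i') (x j')) by auto.
    rewrite (Hg i j i' j') by auto; ring. }
  assert (Nz : forall k, (k < N)%nat -> g (x (S k)) - g (x k) <> 0).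
  { intros k Hk; apply (C1_g_neq a b f g (x (S k)) (x k) H); try (apply Hi; lia).
    assert (L := Hx k Hk); lra. }
  set (u := fun k => f (x k)); set (v := fun k => g (x k)).
  (* The chords from [k] to [k + 3] and from [k + 1] to [k + 2] have the same index sum, so the sum
     of the two outer steps is a multiple of the middle step. The factor is read off from [g], whose
     steps do not vanish. *)
  set (c := fun k => (v (S (S (S k))) - v (S (S k)) + (v (S k) - v k)) / (v (S (S k)) - v (S k))).
  assert (Rv : forall k, (k + 3 <= N)%nat ->
    v (S (S (S k))) - v (S (S k)) + (v (S k) - v k) = c k * (v (S (S k)) - v (S k))).
  { intros k Hk; unfold c; field; apply Nz; lia. }
  assert (Ru : forall k, (k + 3 <= N)%nat ->
    u (S (S (S k))) - u (S (S k)) + (u (S k) - u k) = c k * (u (S (S k)) - u (S k))).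
  { intros k Hk; unfold c.
    assert (E := Par (S (S (S k))) k (S (S k)) (S k) ltac:(lia) ltac:(lia) ltac:(lia) ltac:(lia)
      ltac:(lia)).
    assert (Nk := Nz (S k) ltac:(lia)); fold (v (S k)) (v (S (S k))) in Nk.
    fold (v k) (v (S k)) (v (S (S k))) (v (S (S (S k)))) (u k) (u (S k)) (u (S (S k)))
      (u (S (S (S k)))) in E.
    apply (Rmult_eq_reg_r (v (S (S k)) - v (S k))); auto.
    field_simplify; auto; lra. }
  (* The chord from [k] to [k + 4] equals [c k] times one middle step plus [c (S k)] times the next,
     and it is parallel to the sum of these two steps. They are linearly independent, so the factors
     agree. *)
  assert (Cc : forall k, (k + 4 <= N)%nat -> c k = c (S k)).
  { intros k Hk.
    assert (V1 := Rv k ltac:(lia)); assert (V2 := Rv (S k) ltac:(lia)).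
    assert (U1 := Ru k ltac:(lia)); assert (U2 := Ru (S k) ltac:(lia)).
    assert (E := Par (S (S (S (S k)))) k (S (S (S k))) (S k) ltac:(lia) ltac:(lia) ltac:(lia)
      ltac:(lia) ltac:(lia)).
    assert (D := cauchy_points_not_collinear a b f g (x (S k)) (x (S (S k))) (x (S (S (S k)))) H
      ltac:(apply Hi; lia) ltac:(apply Hi; lia)
      (conj (Hx (S k) ltac:(lia)) (Hx (S (S k)) ltac:(lia)))).
    fold (v k) (v (S k)) (v (S (S k))) (v (S (S (S k)))) (v (S (S (S (S k))))) (u k) (u (S k))
      (u (S (S k))) (u (S (S (S k)))) (u (S (S (S (S k))))) in E, D.
    unfold det3 in D.
    revert V1 V2 U1 U2 E D; generalize (c k) (c (S k)) (v k) (v (S k)) (v (S (S k)))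
      (v (S (S (S k)))) (v (S (S (S (S k))))) (u k) (u (S k))
      (u (S (S k))) (u (S (S (S k)))) (u (S (S (S (S k))))).
    intros c1 c2 v0 v1 v2 v3 v4 u0 u1 u2 u3 u4 V1 V2 U1 U2 E D.
    apply Rminus_diag_uniq.
    apply (Rmult_eq_reg_r ((u2 - u1) * (v3 - v1) - (u3 - u1) * (v2 - v1))); [|exact D].
    replace u4 with (u3 - (u2 - u1) + c2 * (u3 - u2)) in E by lra.
    replace v4 with (v3 - (v2 - v1) + c2 * (v3 - v2)) in E by lra.
    replace u0 with (u1 + (u3 - u2) - c1 * (u2 - u1)) in E by lra.
    replace v0 with (v1 + (v3 - v2) - c1 * (v2 - v1)) in E by lra.
    rewrite Rmult_0_l; apply Rminus_diag_eq in E; rewrite <- E; ring. }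
  assert (C0 : forall k, (k + 3 <= N)%nat -> c k = c 0%nat).
  { induction k as [|k IH]; intros Hk; auto; rewrite <- Cc by lia; apply IH; lia. }
  destruct (recurrence_conic N (c 0%nat) u v) as [Q [HQ Z]].
  - intros k Hk; rewrite <- (C0 k Hk); split; auto.
  - apply (cauchy_points_not_collinear a b f g); auto.
    + apply Hi; lia.
    + apply Hi; lia.
    + split; apply Hx; lia.
  - exists Q; split; auto.
Qed.

(** * From bisymmetry to a conic *)

Lemma st_i_ii (a b : Rbar) (f g : R -> R) : class_C1 a b f g -> st_i a b f g -> st_ii a b f g.
Proof.
  intros H (h & Hc & Hm & E) x y u v Hx Hy Hu Hv.
  assert (In := fun s t => cauchy_mean_in a b f g s t H).
  assert (K : forall s t, inI a b s -> inI a b t ->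
    h (cauchy_mean a b f g s t) = (h s + h t) / 2).
  { intros s t Hs Ht; rewrite E by auto; apply qa_mean_spec; auto. }
  rewrite (E (cauchy_mean a b f g x y)), (E (cauchy_mean a b f g x u)) by auto.
  unfold qa_mean; f_equal; rewrite !K by auto; field.
Qed.

Lemma dyadic_grid (a b : Rbar) (f g : R -> R) (A B : R) :
  class_C1 a b f g -> st_ii a b f g -> inI a b A -> inI a b B -> A < B ->
  forall n, let x := dyadic (cauchy_mean a b f g) A B n in
    is_grid (cauchy_mean a b f g) (2 ^ n) x /\
    (forall i, (i <= 2 ^ n)%nat -> A <= x i <= B) /\
    (forall i, (i < 2 ^ n)%nat -> x i < x (S i)).
Proof.
  intros H Hb HA HB L n; cbv zeta.
  assert (P : forall s, A <= s <= B -> inI a b s) by (intros s; apply inI_convex; auto).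
  assert (In : forall s t, A <= s <= B -> A <= t <= B -> A <= cauchy_mean a b f g s t <= B).
  { intros s t Hs Ht; destruct (Rtotal_order s t) as [Lt|[->|Lt]].
    - assert (T := cauchy_mean_between a b f g s t H (P s Hs) (P t Ht) Lt); lra.
    - rewrite cauchy_mean_diag; auto.
    - rewrite cauchy_mean_sym by auto.
      assert (T := cauchy_mean_between a b f g t s H (P t Ht) (P s Hs) Lt); lra. }
  induction n as [|n (Hg & Hi & Hx)].
  - simpl; repeat split.
    + intros i j i' j' Hi Hj Hi' Hj' E.
      destruct i as [|[|]], j as [|[|]], i' as [|[|]], j' as [|[|]]; try lia; auto;
        apply cauchy_mean_sym; auto.
    + destruct i; lra.
    + destruct i; lra.
    + intros i Hi; destruct i as [|i]; [lra|lia].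
  - replace (2 ^ S n)%nat with (2 * 2 ^ n)%nat by (simpl; lia); repeat split.
    + apply (grid_refine _ (fun s => A <= s <= B)); auto using cauchy_mean_diag.
      intros; apply cauchy_mean_sym; auto.
    + apply In; apply Hi.
      * rewrite <- (div2_even (2 ^ n)); apply Nat.div2_le_mono; lia.
      * rewrite <- (div2_odd (2 ^ n)); apply Nat.div2_le_mono; lia.
    + apply In; apply Hi.
      * rewrite <- (div2_even (2 ^ n)); apply Nat.div2_le_mono; lia.
      * rewrite <- (div2_odd (2 ^ n)); apply Nat.div2_le_mono; lia.
    + apply (refine_grid_mono _ (fun s => A <= s <= B)); auto using cauchy_mean_diag.
      intros; apply cauchy_mean_between; auto.
Qed.

(** The product filter lets both ends of the chord move independently, as they do in the density
    argument. *)
Lemma chord_slope_continuous (f g : R -> R) (p q : R) :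
  continuous f p -> continuous f q -> continuous g p -> continuous g q -> g p - g q <> 0 ->
  filterlim (fun z => (f (fst z) - f (snd z)) / (g (fst z) - g (snd z)))
    (filter_prod (locally p) (locally q)) (locally ((f p - f q) / (g p - g q))).
Proof.
  intros fp fq gp gq N.
  assert (S : forall k : R -> R, continuous k p -> continuous k q ->
    filterlim (fun z => k (fst z) - k (snd z)) (filter_prod (locally p) (locally q))
      (locally (k p - k q))).
  { intros k kp kq.
    apply (filterlim_comp_2 (G := locally (k p)) (H := locally (- k q))
      (fun z => k (fst z)) (fun z => - k (snd z)) Rplus).
    - apply (filterlim_comp _ _ _ fst k _ (locally p)); [apply filterlim_fst|exact kp].
    - apply (filterlim_comp _ _ _ snd (fun s => - k s) _ (locally q)); [apply filterlim_snd|].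
      apply (continuous_opp (V := R_NormedModule)), kq.
    - apply (filterlim_plus (V := R_NormedModule) (k p) (- k q)). }
  apply (filterlim_comp_2 (G := locally (f p - f q)) (H := locally (/ (g p - g q)))
    (fun z => f (fst z) - f (snd z)) (fun z => / (g (fst z) - g (snd z))) Rmult).
  - apply S; auto.
  - apply (filterlim_comp _ _ _ (fun z => g (fst z) - g (snd z)) Rinv _ (locally (g p - g q)));
      [apply S; auto|].
    apply (continuous_Rinv_comp (fun s => s)); auto; apply continuous_id.
  - apply (filterlim_mult (K := R_AbsRing)).
Qed.

(* A gap (p, q) of the closure of S would contain the means of points of S close to p and q. *)
Lemma cauchy_closed_dense (a b : Rbar) (f g : R -> R) (S : R -> Prop) (A B : R) :
  class_C1 a b f g -> inI a b A -> inI a b B -> S A -> S B ->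
  (forall s, S s -> A <= s <= B) -> (forall s t, S s -> S t -> S (cauchy_mean a b f g s t)) ->
  forall t e, 0 < e -> A <= t <= B -> exists s, S s /\ Rabs (s - t) < e.
Proof.
  intros H HA HB SA SB SI SM t e He Ht.
  assert (P : forall s, A <= s <= B -> inI a b s) by (intros s; apply inI_convex; auto).
  destruct (completeness (fun s => S s /\ s <= t)) as [p [Hp1 Hp2]].
  { exists t; intros s [_ Hs]; auto. }
  { exists A; split; [auto|lra]. }
  (* The infimum [q] of the points of [S] above [t], as minus the supremum of their opposites. *)
  destruct (completeness (fun s => S (- s) /\ t <= - s)) as [q' [Hq1' Hq2']].
  { exists (- t); intros s [_ Hs]; lra. }
  { exists (- B); rewrite Ropp_involutive; split; [auto|lra]. }
  set (q := - q').
  assert (Hq1 : forall s, S s -> t <= s -> q <= s).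
  { intros s Hs Lt; assert (T := Hq1' (- s)); simpl in T; rewrite Ropp_involutive in T.
    specialize (T (conj Hs Lt)); unfold q; lra. }
  assert (Hp : A <= p <= t).
  { split; [apply Hp1; split; auto; lra|apply Hp2; intros s [_ Hs]; auto]. }
  assert (Hq : t <= q <= B).
  { split; [|apply Hq1; auto; lra].
    assert (T : q' <= - t) by (apply Hq2'; intros s [_ Hs]; lra); unfold q; lra. }
  assert (Np : forall d, 0 < d -> exists s, S s /\ s <= t /\ p - d < s <= p).
  { intros d Hd; apply NNPP; intros N; assert (p <= p - d); [|lra].
    apply Hp2; intros s [Hs Lt]; destruct (Rle_dec s (p - d)); auto; exfalso; apply N.
    exists s; split; [auto|split; [auto|split; [lra|apply Hp1; auto]]]. }
  assert (Nq : forall d, 0 < d -> exists s, S s /\ t <= s /\ q <= s < q + d).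
  { intros d Hd; apply NNPP; intros N; assert (q' <= q' - d); [|lra].
    apply Hq2'; intros s [Hs Lt]; destruct (Rle_dec s (q' - d)); auto; exfalso; apply N.
    assert (T := Hq1' s (conj Hs Lt)).
    exists (- s); split; [auto|split; [auto|unfold q; lra]]. }
  destruct (Req_EM_T p t) as [->|Npt].
  { destruct (Np e He) as (s & Hs & _ & Ls); exists s; split; auto; apply Rabs_def1; lra. }
  exfalso; assert (L : p < q) by lra.
  assert (Ip : inI a b p) by (apply P; lra); assert (Iq : inI a b q) by (apply P; lra).
  destruct (C1_facts a b f g H) as (Df & Dg & _).
  assert (Cf := cont_on_derive a b f _ Df); assert (Cg := cont_on_derive a b g _ Dg).
  assert (Ng : g p - g q <> 0) by (apply (C1_g_neq a b f g p q H Ip Iq); lra).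
  assert (Lm := chord_slope_continuous f g p q (Cf p Ip) (Cf q Iq) (Cg p Ip) (Cg q Iq) Ng).
  set (r := fun s => Derive f s / Derive g s).
  set (m := cauchy_mean a b f g p q).
  assert (Hm : p < m < q) by (apply cauchy_mean_between; auto).
  assert (Im : inI a b m) by (apply P; lra).
  assert (Er : (f p - f q) / (g p - g q) = r m).
  { rewrite (cauchy_mean_chord a b f g p q) by auto; fold m; fold (r m); field; auto. }
  rewrite Er in Lm.
  assert (Hr : strict_mono_on a b r) by apply H.
  (* The argument runs on slopes, so continuity of the mean itself does not enter: [U] is a
     neighbourhood of the slope over [(p, q)], hence contains the slopes of nearby chords, and by
     monotonicity of [r] their means fall strictly inside the gap. *)
  set (U := fun s => Rmin (r p) (r q) < s < Rmax (r p) (r q)).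
  assert (LU : locally (r m) U).
  { assert (Hu : U (r m)).
    { unfold U, Rmin, Rmax; destruct Hr as [Hr|Hr];
        assert (T1 := Hr p m Ip Im (proj1 Hm)); assert (T2 := Hr m q Im Iq (proj2 Hm));
        destruct (Rle_dec (r p) (r q)); lra. }
    apply filter_and; [apply open_gt|apply open_lt]; apply Hu. }
  specialize (Lm U LU); destruct Lm as [V1 V2 [d1 W1] [d2 W2] Q].
  destruct (Np d1 (cond_pos d1)) as (s1 & S1 & T1 & B1).
  destruct (Nq d2 (cond_pos d2)) as (s2 & S2 & T2 & B2).
  assert (Hu : U ((f s1 - f s2) / (g s1 - g s2))).
  { apply (Q s1 s2).
    - apply W1, Rabs_def1; unfold minus, plus, opp; simpl; lra.
    - apply W2, Rabs_def1; unfold minus, plus, opp; simpl; lra. }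
  assert (I1 : inI a b s1) by (apply P, SI, S1); assert (I2 : inI a b s2) by (apply P, SI, S2).
  assert (Ng' : g s1 - g s2 <> 0) by (apply (C1_g_neq a b f g s1 s2 H I1 I2); lra).
  set (m' := cauchy_mean a b f g s1 s2).
  assert (Sm := SM s1 s2 S1 S2); fold m' in Sm.
  assert (Im' : inI a b m') by (apply P, SI, Sm).
  replace ((f s1 - f s2) / (g s1 - g s2)) with (r m') in Hu.
  2: { rewrite (cauchy_mean_chord a b f g s1 s2) by auto; fold m'; fold (r m'); field; auto. }
  assert (M : m' <= p \/ q <= m').
  { destruct (Rle_dec m' t); [left; apply Hp1; auto|right; apply Hq1; auto; lra]. }
  assert (T : Rmin (r p) (r q) <= r p <= Rmax (r p) (r q)
    /\ Rmin (r p) (r q) <= r q <= Rmax (r p) (r q))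
    by (split; apply (strict_mono_on_between a b r p _ q); auto; lra).
  unfold U in Hu; destruct M as [M|M].
  - assert (Z := strict_mono_on_between a b r m' p q Hr Im' Iq ltac:(lra)).
    revert Hu Z T; unfold Rmin, Rmax; destruct (Rle_dec (r p) (r q)), (Rle_dec (r m') (r q)); lra.
  - assert (Z := strict_mono_on_between a b r p q m' Hr Ip Im' ltac:(lra)).
    revert Hu Z T; unfold Rmin, Rmax; destruct (Rle_dec (r p) (r q)), (Rle_dec (r p) (r m')); lra.
Qed.

Lemma dense_zero (S : R -> Prop) (phi : R -> R) (t : R) :
  continuous phi t -> (forall e, 0 < e -> exists s, S s /\ Rabs (s - t) < e) ->
  (forall s, S s -> phi s = 0) -> phi t = 0.
Proof.
  intros C D Z; apply NNPP; intros N.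
  assert (Hp := Rabs_pos_lt _ N).
  destruct (proj1 (filterlim_locally phi (phi t)) C (mkposreal _ Hp)) as [d Hd].
  destruct (D d (cond_pos d)) as [s [Hs Ls]].
  assert (T := Hd s Ls); unfold ball in T; simpl in T; unfold AbsRing_ball, abs in T;
    unfold minus, plus, opp in T; simpl in T; rewrite (Z s Hs), Rplus_0_l, Rabs_Ropp in T; lra.
Qed.

Lemma dyadic_conic (a b : Rbar) (f g : R -> R) (A B : R) :
  class_C1 a b f g -> st_ii a b f g -> inI a b A -> inI a b B -> A < B ->
  exists Q, is_conic Q /\ forall t, A <= t <= B -> Q (f t) (g t) = 0.
Proof.
  intros H Hb HA HB L.
  assert (G := dyadic_grid a b f g A B H Hb HA HB L).
  assert (P : forall s, A <= s <= B -> inI a b s) by (intros s; apply inI_convex; auto).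
  set (M := cauchy_mean a b f g) in *.
  assert (Md : forall s, M s s = s) by (intros; apply cauchy_mean_diag).
  set (X := dyadic M A B) in *.
  assert (Cn : forall n, (2 <= n)%nat ->
    exists Q, is_conic Q /\ forall k, (k <= 2 ^ n)%nat -> Q (f (X n k)) (g (X n k)) = 0).
  { intros n Hn; destruct (G n) as (G1 & G2 & G3).
    apply (grid_conic a b f g (2 ^ n) (X n) H); auto.
    assert (T := Nat.pow_le_mono_r 2 2 n); simpl in T; lia. }
  (* Level 2 is the first with five points, enough to fix the conic for all finer levels. *)
  destruct (Cn 2%nat (le_n 2)) as [Q [HQ ZQ]].
  assert (Zn : forall n k, (2 <= n)%nat -> (k <= 2 ^ n)%nat -> Q (f (X n k)) (g (X n k)) = 0).
  { intros n k Hn Hk; destruct (Cn n Hn) as [Q' [HQ' ZQ']].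
    apply (conic_unique Q Q' (fun i => f (X 2%nat i)) (fun i => g (X 2%nat i))); auto.
    - intros i Hi; split; [apply ZQ; simpl; lia|].
      unfold X; rewrite <- (dyadic_scale M A B 2 (n - 2) i Md).
      replace (n - 2 + 2)%nat with n by lia; apply ZQ'.
      replace (2 ^ n)%nat with (2 ^ (n - 2) * 2 ^ 2)%nat
        by (rewrite <- Nat.pow_add_r; f_equal; lia).
      apply Nat.mul_le_mono_l; simpl; lia.
    - intros i j k' H1 H2 H3; destruct (G 2%nat) as (G1 & G2 & G3).
      apply (cauchy_points_not_collinear a b f g _ _ _ H).
      + apply P, G2; simpl; lia.
      + apply P, G2; simpl; lia.
      + split; apply (grid_mono_lt (2 ^ 2) (X 2%nat) G3); simpl; lia. }
  exists Q; split; auto; intros t Ht.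
  set (S := fun s => exists n k, (k <= 2 ^ n)%nat /\ s = X n k).
  assert (SC : forall s n k m, (k <= 2 ^ n)%nat -> s = X n k ->
    (2 ^ m * k <= 2 ^ (m + n))%nat /\ s = X (m + n)%nat (2 ^ m * k)%nat).
  { intros s n k m Hk ->; split.
    - rewrite Nat.pow_add_r; apply Nat.mul_le_mono_l; auto.
    - symmetry; apply dyadic_scale; auto. }
  apply (dense_zero S (fun t => Q (f t) (g t))).
  - destruct (C1_facts a b f g H) as (Df & Dg & _).
    destruct HQ as (al & be & ga & de & ep & et & _ & E).
    apply (continuous_ext (fun t => quad al be ga de ep et (f t) (g t))).
    { intros s; symmetry; apply E. }
    apply (ex_derive_continuous (V := R_NormedModule)).
    assert (A1 := Df t (P t Ht)); assert (A2 := Dg t (P t Ht)).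
    unfold quad; auto_derive; repeat split; eexists; eassumption.
  - intros e He; apply (cauchy_closed_dense a b f g S A B); auto.
    + exists 0%nat, 0%nat; split; [lia|reflexivity].
    + exists 0%nat, 1%nat; split; [simpl; lia|reflexivity].
    + intros s (n & k & Hk & ->); apply (G n); auto.
    + intros s u (n & k & Hk & Es) (m & l & Hl & Eu).
      destruct (SC s n k m Hk Es) as [Hk' Es']; destruct (SC u m l n Hl Eu) as [Hl' Eu'].
      rewrite (Nat.add_comm n m) in Hl', Eu'.
      (* Once both points are on level [m + n], the mean of the points of indices [i] and [j] is the
         point of index [i + j] one level further. *)
      exists (Datatypes.S (m + n)), (2 ^ m * k + 2 ^ n * l)%nat; split; [simpl; lia|].
      rewrite Es', Eu'.
      destruct (G (m + n)%nat) as (G1 & G2 & G3).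
      unfold X at 3; simpl; unfold refine_grid; fold M X.
      generalize Hk' Hl'; generalize (2 ^ m * k)%nat (2 ^ n * l)%nat; clear - G1.
      intros i j Hi Hj; apply G1; auto.
      * rewrite <- (div2_even (2 ^ (m + n))); apply Nat.div2_le_mono; lia.
      * rewrite <- (div2_odd (2 ^ (m + n))); apply Nat.div2_le_mono; lia.
      * destruct (Nat.Even_or_Odd (i + j)) as [[s Hs]|[s Hs]].
        -- rewrite Hs, div2_even, div2_odd; lia.
        -- replace (Datatypes.S (i + j)) with (2 * (s + 1))%nat by lia.
           replace (i + j)%nat with (Datatypes.S (2 * s)) by lia.
           rewrite div2_even, div2_odd; lia.
  (* Raising the level by two brings the points of levels 0 and 1 within reach of [Zn]. *)
  - intros s (n & k & Hk & Es); destruct (SC s n k 2%nat Hk Es) as [Hk' Es'].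
    rewrite Es'; apply Zn; auto; lia.
Qed.

Lemma st_ii_iii (a b : Rbar) (f g : R -> R) : Rbar_lt a b ->
  class_C1 a b f g -> st_ii a b f g -> st_iii a b f g.
Proof.
  intros Hab H Hb.
  destruct (inI_inhabited a b Hab) as [A HA]; destruct (inI_right a b A HA) as [B [HB L]].
  destruct (dyadic_conic a b f g A B H Hb HA HB L) as [Q [HQ ZQ]].
  assert (Z : forall t, inI a b t -> Q (f t) (g t) = 0).
  { intros t Ht.
    (* The dyadic argument covers only a compact interval. One that also contains [t] gives a conic
       [Q'], which shares with [Q] five equally spaced parameters of [[A, B]]. *)
    destruct (dyadic_conic a b f g (Rmin A t) (Rmax B t) H Hb) as [Q' [HQ' ZQ']].
    - unfold Rmin; destruct (Rle_dec A t); auto.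
    - unfold Rmax; destruct (Rle_dec B t); auto.
    - unfold Rmin, Rmax; destruct (Rle_dec A t), (Rle_dec B t); lra.
    - set (x := fun i : nat => A + INR i * ((B - A) / 4)).
      assert (Hx : forall i, (i <= 4)%nat -> A <= x i <= B).
      { intros i Hi; apply le_INR in Hi; replace (INR 4) with 4 in Hi by (simpl; ring).
        assert (T := pos_INR i); unfold x; split; nra. }
      assert (P : forall s, A <= s <= B -> inI a b s) by (intros s; apply inI_convex; auto).
      apply (conic_unique Q Q' (fun i => f (x i)) (fun i => g (x i))); auto.
      + intros i Hi; split; [apply ZQ, Hx, Hi|apply ZQ'].
        assert (T := Hx i Hi); unfold Rmin, Rmax; destruct (Rle_dec A t), (Rle_dec B t); lra.
      + intros i j k H1 H2 H3; apply (cauchy_points_not_collinear a b f g _ _ _ H).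
        * apply P, Hx; lia.
        * apply P, Hx; lia.
        * apply lt_INR in H1, H2; unfold x; split; nra.
      + apply ZQ'; unfold Rmin, Rmax; destruct (Rle_dec A t), (Rle_dec B t); lra. }
  destruct HQ as (al & be & ga & de & ep & et & N & E).
  exists al, be, ga, de, ep, et; split; auto.
  intros x Hx; specialize (Z x Hx); rewrite E in Z; exact Z.
Qed.

(** * From a conic to a quasiarithmetic mean *)

(** Fundamental solutions of [y'' = kap * y]: trigonometric, polynomial or hyperbolic. [K] is the
    antiderivative of [S], needed to integrate the flow once more; it is [(C - 1) / kap] except at
    [kap = 0]. *)
Lemma sine_cosine (kap : R) : exists S C K : R -> R,
  (forall t, is_derive S t (C t)) /\ (forall t, is_derive C t (kap * S t)) /\
  (forall t, is_derive K t (S t)) /\ S 0 = 0 /\ C 0 = 1 /\ K 0 = 0 /\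
  (forall t, S (- t) = - S t) /\ (forall t, C (- t) = C t) /\ (forall t, K (- t) = K t) /\
  (forall t, C t ^ 2 - kap * S t ^ 2 = 1).
Proof.
  destruct (Rtotal_order kap 0) as [L|[->|L]].
  - set (r := sqrt (- kap)).
    assert (Er : kap = - (r * r)) by (unfold r; rewrite sqrt_sqrt; lra).
    assert (Hr : r <> 0) by (intros E; rewrite E in Er; lra).
    exists (fun t => sin (r * t) / r), (fun t => cos (r * t)),
      (fun t => (cos (r * t) - 1) / kap); rewrite Er.
    splits; intros; rewrite ?Rmult_0_r, ?sin_0, ?cos_0, ?Ropp_mult_distr_r_reverse,
      ?sin_neg, ?cos_neg; try solve [field; nra].
    + auto_derive; auto; field; auto.
    + auto_derive; auto; field; auto.
    + auto_derive; [nra|]; field; nra.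
    + assert (T := sin2_cos2 (r * t)); unfold Rsqr in T; rewrite <- T; field; auto.
  - exists (fun t => t), (fun t => 1), (fun t => t ^ 2 / 2).
    splits; intros; try field; auto_derive; auto; field.
  - set (r := sqrt kap).
    assert (Er : kap = r * r) by (unfold r; rewrite sqrt_sqrt; lra).
    assert (Hr : r <> 0) by (intros E; rewrite E in Er; lra).
    exists (fun t => (exp (r * t) - exp (- (r * t))) / (2 * r)),
      (fun t => (exp (r * t) + exp (- (r * t))) / 2),
      (fun t => ((exp (r * t) + exp (- (r * t))) / 2 - 1) / kap); rewrite Er.
    splits; intros; rewrite ?Ropp_mult_distr_r_reverse, ?Ropp_involutive, ?Rmult_0_r, ?Ropp_0,
      ?exp_0; try solve [field; auto].
    + auto_derive; auto; field; auto.
    + auto_derive; auto; field; auto.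
    + auto_derive; [nra|]; field; nra.
    + rewrite exp_Ropp; assert (T := exp_pos (r * t)); field; lra.
Qed.

(* [(F, G)] solves a linear system with a trace-free constant matrix in the variable [h], so it is
   a matrix exponential with [C] and [S] as its even and odd parts around [m]. *)
Lemma linear_flow (a b : Rbar) (f g h F G k : R -> R) (p q r : R) :
  (forall x, inI a b x -> is_derive h x (k x)) ->
  (forall x, inI a b x -> is_derive f x (k x * F x)) ->
  (forall x, inI a b x -> is_derive g x (k x * G x)) ->
  (forall x, inI a b x -> is_derive F x (k x * (q * F x + r * G x))) ->
  (forall x, inI a b x -> is_derive G x (- (k x * (p * F x + q * G x)))) ->
  forall x y m, inI a b x -> inI a b y -> inI a b m -> h x + h y = 2 * h m ->
  exists s c, f x - f y = s * F m /\ g x - g y = s * G m /\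
    F x + F y = c * F m /\ G x + G y = c * G m.
Proof.
  intros Dh Df Dg DF DG x y m Hx Hy Hm E.
  (* The matrix has rows [(q, r)] and [(-p, -q)]; its square is [q * q - p * r] times the
     identity. *)
  destruct (sine_cosine (q * q - p * r)) as
    (S & C & K & DS & DC & DK & S0 & C0 & K0 & SN & CN & KN & Id).
  (* [Z1] and [Z2] apply the inverse exponential [C - S A] to [(F, G)] and find a constant, which
     stands in for a uniqueness theorem. [EF] and [EG] invert this by [C ^ 2 - kap * S ^ 2 = 1]. *)
  assert (Z1 : forall x, inI a b x ->
    C (h x - h m) * F x - S (h x - h m) * (q * F x + r * G x) = F m).
  { intros z Hz.
    transitivity (C (h m - h m) * F m - S (h m - h m) * (q * F m + r * G m)).
    2: { rewrite Rminus_diag, S0, C0; ring. }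
    apply (derive_zero_const a b
      (fun x => C (h x - h m) * F x - S (h x - h m) * (q * F x + r * G x)));
      auto.
    intros t Ht; specialize (Dh t Ht); specialize (Df t Ht); specialize (Dg t Ht).
    specialize (DF t Ht); specialize (DG t Ht).
    specialize (DS (h t + - h m)); specialize (DC (h t + - h m)).
    solve_derive; ring. }
  assert (Z2 : forall x, inI a b x ->
    C (h x - h m) * G x + S (h x - h m) * (p * F x + q * G x) = G m).
  { intros z Hz.
    transitivity (C (h m - h m) * G m + S (h m - h m) * (p * F m + q * G m)).
    2: { rewrite Rminus_diag, S0, C0; ring. }
    apply (derive_zero_const a b
      (fun x => C (h x - h m) * G x + S (h x - h m) * (p * F x + q * G x)));
      auto.
    intros t Ht; specialize (Dh t Ht); specialize (Df t Ht); specialize (Dg t Ht).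
    specialize (DF t Ht); specialize (DG t Ht).
    specialize (DS (h t + - h m)); specialize (DC (h t + - h m)).
    solve_derive; ring. }
  assert (EF : forall x, inI a b x ->
    F x = C (h x - h m) * F m + S (h x - h m) * (q * F m + r * G m)).
  { intros z Hz; rewrite <- (Z1 z Hz), <- (Z2 z Hz); specialize (Id (h z - h m)).
    transitivity ((C (h z - h m) ^ 2 - (q * q - p * r) * S (h z - h m) ^ 2) * F z); [|ring].
    rewrite Id; ring. }
  assert (EG : forall x, inI a b x ->
    G x = C (h x - h m) * G m - S (h x - h m) * (p * F m + q * G m)).
  { intros z Hz; rewrite <- (Z1 z Hz), <- (Z2 z Hz); specialize (Id (h z - h m)).
    transitivity ((C (h z - h m) ^ 2 - (q * q - p * r) * S (h z - h m) ^ 2) * G z); [|ring].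
    rewrite Id; ring. }
  (* Integrating the formula for [F] in the variable [h] replaces [C], [S] by their antiderivatives
     [S], [K]. *)
  assert (Zf : forall x, inI a b x ->
    f x - S (h x - h m) * F m - K (h x - h m) * (q * F m + r * G m) = f m).
  { intros z Hz.
    transitivity (f m - S (h m - h m) * F m - K (h m - h m) * (q * F m + r * G m)).
    2: { rewrite Rminus_diag, S0, K0; ring. }
    apply (derive_zero_const a b
      (fun x => f x - S (h x - h m) * F m - K (h x - h m) * (q * F m + r * G m)));
      auto.
    intros t Ht; assert (T := EF t Ht); specialize (Dh t Ht); specialize (Df t Ht).
    specialize (DS (h t + - h m)); specialize (DK (h t + - h m)).
    solve_derive; rewrite T; unfold Rminus; ring. }
  assert (Zg : forall x, inI a b x ->
    g x - S (h x - h m) * G m + K (h x - h m) * (p * F m + q * G m) = g m).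
  { intros z Hz.
    transitivity (g m - S (h m - h m) * G m + K (h m - h m) * (p * F m + q * G m)).
    2: { rewrite Rminus_diag, S0, K0; ring. }
    apply (derive_zero_const a b
      (fun x => g x - S (h x - h m) * G m + K (h x - h m) * (p * F m + q * G m)));
      auto.
    intros t Ht; assert (T := EG t Ht); specialize (Dh t Ht); specialize (Dg t Ht).
    specialize (DS (h t + - h m)); specialize (DK (h t + - h m)).
    solve_derive; rewrite T; unfold Rminus; ring. }
  (* Opposite arguments: the even [K] cancels in the differences of [f] and [g], the odd [S] in the
     sums of [F] and [G]. *)
  assert (Ey : h y - h m = - (h x - h m)) by lra.
  exists (2 * S (h x - h m)), (2 * C (h x - h m)).
  assert (A1 := Zf x Hx); assert (A2 := Zf y Hy); rewrite Ey, SN, KN in A2.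
  assert (B1 := Zg x Hx); assert (B2 := Zg y Hy); rewrite Ey, SN, KN in B2.
  rewrite (EF x Hx), (EF y Hy), (EG x Hx), (EG y Hy), Ey, SN, CN.
  repeat split; lra.
Qed.

Lemma linear_flow_cauchy_mean (a b : Rbar) (f g h F G k : R -> R) (p q r : R) :
  class_C1 a b f g ->
  (forall x, inI a b x -> is_derive h x (k x)) -> strict_mono_on a b h ->
  (forall x, inI a b x -> k x <> 0) ->
  (forall x, inI a b x -> is_derive f x (k x * F x)) ->
  (forall x, inI a b x -> is_derive g x (k x * G x)) ->
  (forall x, inI a b x -> is_derive F x (k x * (q * F x + r * G x))) ->
  (forall x, inI a b x -> is_derive G x (- (k x * (p * F x + q * G x)))) ->
  forall x y, inI a b x -> inI a b y -> cauchy_mean a b f g x y = qa_mean a b h x y.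
Proof.
  intros H Dh Mh Nk Df Dg DF DG x y Hx Hy.
  assert (Ch := cont_on_derive a b h k Dh).
  destruct (qa_mean_spec a b h x y Ch Hx Hy) as [Hm Em].
  set (m := qa_mean a b h x y) in *.
  destruct (Req_EM_T x y) as [->|N].
  { rewrite cauchy_mean_diag; apply (strict_mono_on_inj a b h); auto; lra. }
  destruct (linear_flow a b f g h F G k p q r Dh Df Dg DF DG x y m) as (s & c & E1 & E2 & _);
    auto; [lra|].
  apply cauchy_mean_eq; auto.
  rewrite E1, E2, (is_derive_unique _ _ _ (Df m Hm)), (is_derive_unique _ _ _ (Dg m Hm)).
  assert (Ng : Derive g m <> 0) by (apply H; auto).
  rewrite (is_derive_unique _ _ _ (Dg m Hm)) in Ng.
  field; split; intros Z; apply Ng; rewrite Z; ring.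
Qed.

Lemma three_roots (p q r x y z : R) : x <> y -> y <> z -> x <> z ->
  p * x ^ 2 + q * x + r = 0 -> p * y ^ 2 + q * y + r = 0 -> p * z ^ 2 + q * z + r = 0 ->
  p = 0 /\ q = 0 /\ r = 0.
Proof.
  intros N1 N2 N3 X Y Z.
  assert (E1 : p * (x + y) + q = 0) by (apply (Rmult_eq_reg_l (x - y)); [lra|lra]).
  assert (E2 : p * (x + z) + q = 0) by (apply (Rmult_eq_reg_l (x - z)); [lra|lra]).
  assert (Hp : p = 0) by (apply (Rmult_eq_reg_l (y - z)); lra).
  subst p; assert (q = 0) by lra; subst q; repeat split; lra.
Qed.

(* If the gradient of the conic vanished at a point of the curve, the slopes of the chords through
   that point would be roots of one quadratic equation, but they are pairwise distinct. *)
Lemma conic_gradient_neq (a b : Rbar) (f g : R -> R) (al be ga de ep et : R) :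
  class_C1 a b f g -> ~ (al = 0 /\ be = 0 /\ ga = 0) ->
  (forall x, inI a b x -> quad al be ga de ep et (f x) (g x) = 0) ->
  forall x, inI a b x -> 2 * al * f x + be * g x + de = 0 ->
    be * f x + 2 * ga * g x + ep = 0 -> False.
Proof.
  intros H N Z x Hx U V; unfold quad in Z.
  (* Where the polynomial and its gradient both vanish, only the leading form in the increments is
     left. *)
  assert (Q : forall t, inI a b t ->
    al * (f t - f x) ^ 2 + be * (f t - f x) * (g t - g x) + ga * (g t - g x) ^ 2 = 0).
  { intros t Ht; assert (A := Z t Ht); assert (B := Z x Hx).
    replace de with (- (2 * al * f x + be * g x)) in A, B by lra.
    replace ep with (- (be * f x + 2 * ga * g x)) in A, B by lra.
    rewrite <- B in A; apply Rminus_diag_eq in A; rewrite <- A; ring. }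
  destruct (inI_right a b x Hx) as (x1 & I1 & L1); destruct (inI_right a b x1 I1) as (x2 & I2 & L2);
    destruct (inI_right a b x2 I2) as (x3 & I3 & L3).
  set (s := fun t => (f t - f x) / (g t - g x)).
  assert (Ng : forall t, inI a b t -> x < t -> g t - g x <> 0).
  { intros t Ht L; apply (C1_g_neq a b f g t x H Ht Hx); lra. }
  assert (R : forall t, inI a b t -> x < t -> al * s t ^ 2 + be * s t + ga = 0).
  { intros t Ht L; assert (Nt := Ng t Ht L); assert (Qt := Q t Ht).
    apply (Rmult_eq_reg_r ((g t - g x) ^ 2)); [|apply pow_nonzero; auto].
    rewrite Rmult_0_l, <- Qt; unfold s; field; auto. }
  assert (Ds : forall t u, inI a b t -> inI a b u -> x < t < u -> s t <> s u).
  { intros t u Ht Hu L E.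
    apply (cauchy_points_not_collinear a b f g x t u H Hx Hu L).
    assert (Nt := Ng t Ht (proj1 L)); assert (Nu := Ng u Hu ltac:(lra)).
    unfold det3; replace (f t - f x) with (s t * (g t - g x)) by (unfold s; field; auto).
    replace (f u - f x) with (s u * (g u - g x)) by (unfold s; field; auto).
    rewrite E; ring. }
  apply N, (three_roots al be ga (s x1) (s x2) (s x3)); try (apply Ds; auto; lra); apply R; auto; lra.
Qed.

(** Differentiating the equation of the conic shows [(f', g')] to be orthogonal to its gradient,
    hence parallel to the rotated gradient [(F, G)]. As [F] and [G] are affine in [f] and [g], their
    derivatives are linear in [f' = k F] and [g' = k G]. *)
Lemma conic_flow (a b : Rbar) (f g : R -> R) (al be ga de ep et : R) :
  class_C1 a b f g -> ~ (al = 0 /\ be = 0 /\ ga = 0) ->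
  (forall x, inI a b x -> quad al be ga de ep et (f x) (g x) = 0) ->
  exists F G k, cont_on a b k /\ (forall x, inI a b x -> k x <> 0) /\
    (forall x, inI a b x -> is_derive f x (k x * F x)) /\
    (forall x, inI a b x -> is_derive g x (k x * G x)) /\
    (forall x, inI a b x -> is_derive F x (k x * (- be * F x + - (2 * ga) * G x))) /\
    (forall x, inI a b x -> is_derive G x (- (k x * (- (2 * al) * F x + - be * G x)))).
Proof.
  intros H N Z; destruct (C1_facts a b f g H) as (Df & Dg & Cf & Cg & _).
  set (F := fun x => - (be * f x + 2 * ga * g x + ep)).
  set (G := fun x => 2 * al * f x + be * g x + de).
  assert (DF : forall x, inI a b x -> is_derive F x (- (be * Derive f x + 2 * ga * Derive g x))).
  { intros x Hx; assert (A := Df x Hx); assert (B := Dg x Hx); unfold F; solve_derive; ring. }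
  assert (DG : forall x, inI a b x -> is_derive G x (2 * al * Derive f x + be * Derive g x)).
  { intros x Hx; assert (A := Df x Hx); assert (B := Dg x Hx); unfold G; solve_derive; ring. }
  assert (O : forall x, inI a b x -> G x * Derive f x - F x * Derive g x = 0).
  { intros x Hx; assert (A := Df x Hx); assert (B := Dg x Hx).
    assert (D1 : is_derive (fun t => quad al be ga de ep et (f t) (g t)) x
      (G x * Derive f x - F x * Derive g x)).
    { unfold quad, F, G; solve_derive; ring. }
    assert (D2 : is_derive (fun t => quad al be ga de ep et (f t) (g t)) x 0).
    { apply (is_derive_ext_loc (fun _ => 0)); [|apply (is_derive_const (V := R_NormedModule))].
      apply (filter_imp (inI a b)); [intros t Ht; symmetry; auto|apply inI_locally, Hx]. }
    rewrite <- (is_derive_unique _ _ _ D1); apply (is_derive_unique _ _ _ D2). }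
  assert (Ng : forall x, inI a b x -> Derive g x <> 0) by apply H.
  (* A zero of [G] would force [F = 0] because [g'] does not vanish, and the whole gradient would be
     zero. *)
  assert (NG : forall x, inI a b x -> G x <> 0).
  { intros x Hx E; assert (Ox := O x Hx); rewrite E in Ox.
    assert (EF : F x = 0).
    { apply (Rmult_eq_reg_r (Derive g x)); [lra|auto]. }
    apply (conic_gradient_neq a b f g al be ga de ep et H N Z x Hx); [exact E|].
    unfold F in EF; lra. }
  set (k := fun x => Derive g x / G x).
  assert (Ef : forall x, inI a b x -> Derive f x = k x * F x).
  { intros x Hx; assert (Ox := O x Hx); apply (Rmult_eq_reg_l (G x)); auto.
    unfold k; field_simplify; auto; lra. }
  assert (Eg : forall x, inI a b x -> Derive g x = k x * G x).
  { intros x Hx; unfold k; field; auto. }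
  exists F, G, k; splits.
  - intros x Hx; apply (continuous_mult (Derive g) (fun t => / G t)); [apply Cg, Hx|].
    apply continuous_Rinv_comp; auto; apply (cont_on_derive a b G _ DG x Hx).
  - intros x Hx E; apply (Ng x Hx); rewrite (Eg x Hx), E; ring.
  - intros x Hx; rewrite <- (Ef x Hx); auto.
  - intros x Hx; rewrite <- (Eg x Hx); auto.
  - intros x Hx; evar_last; [apply (DF x Hx)|]; rewrite (Ef x Hx), (Eg x Hx); ring.
  - intros x Hx; evar_last; [apply (DG x Hx)|]; rewrite (Ef x Hx), (Eg x Hx); ring.
Qed.

Lemma st_iii_i (a b : Rbar) (f g : R -> R) : Rbar_lt a b ->
  class_C1 a b f g -> st_iii a b f g -> st_i a b f g.
Proof.
  intros Hab H (al & be & ga & de & ep & et & N & Z).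
  destruct (conic_flow a b f g al be ga de ep et H N Z) as (F & G & k & Ck & Nk & Df & Dg & DF & DG).
  destruct (antiderivative_exists a b k Hab Ck) as [h Dh].
  assert (Mh := strict_mono_derive a b h k Dh Nk Ck).
  exists h; split; [exact (cont_on_derive a b h k Dh)|split; auto].
  exact (linear_flow_cauchy_mean a b f g h F G k _ _ _ H Dh Mh Nk Df Dg DF DG).
Qed.

(** * The cube root of the Wronskian *)

Lemma cube_inj (x y : R) : x ^ 3 = y ^ 3 -> x = y.
Proof.
  intros E; assert (Z : (x - y) * ((x + y / 2) ^ 2 + 3 / 4 * y ^ 2) = 0)
    by (transitivity (x ^ 3 - y ^ 3); [field|lra]).
  apply Rmult_integral in Z; destruct Z as [Z|Z]; [lra|].
  assert (A := pow2_ge_0 (x + y / 2)); assert (B := pow2_ge_0 y).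
  assert (Y : y = 0) by (apply (Rsqr_0_uniq y); unfold Rsqr; lra).
  subst y; apply (Rsqr_0_uniq x); unfold Rsqr; lra.
Qed.

Lemma Rpower_third_cube (x : R) : 0 < x -> Rpower x (1 / 3) ^ 3 = x.
Proof.
  intros Hx; rewrite <- Rpower_pow by apply exp_pos.
  rewrite Rpower_mult; replace (1 / 3 * INR 3) with 1 by (simpl; field); apply Rpower_1, Hx.
Qed.

Lemma cbrt_cube (x : R) : cbrt x ^ 3 = x.
Proof.
  unfold cbrt; destruct (Rlt_dec 0 x) as [P|P]; [apply Rpower_third_cube, P|].
  destruct (Rlt_dec x 0) as [N|N].
  - replace ((- Rpower (- x) (1 / 3)) ^ 3) with (- Rpower (- x) (1 / 3) ^ 3) by ring.
    rewrite Rpower_third_cube; lra.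
  - replace x with 0 by lra; ring.
Qed.

Lemma cbrt_neq_0 (x : R) : x <> 0 -> cbrt x <> 0.
Proof. intros N E; apply N; rewrite <- (cbrt_cube x), E; ring. Qed.

Lemma is_derive_cbrt (x : R) : x <> 0 -> is_derive cbrt x (/ (3 * cbrt x ^ 2)).
Proof.
  intros N; assert (Nc := cbrt_neq_0 x N).
  assert (E : / (3 * cbrt x ^ 2) = cbrt x / (3 * x)).
  { rewrite <- (cbrt_cube x) at 3; field; auto. }
  rewrite E; destruct (Rdichotomy _ _ N) as [L|L].
  - apply (is_derive_ext_loc (fun t => - exp (1 / 3 * ln (- t)))).
    + apply (filter_imp (fun t => t < 0)); [|apply open_lt, L].
      intros t Ht; unfold cbrt; destruct (Rlt_dec 0 t); [lra|]; destruct (Rlt_dec t 0); [auto|lra].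
    + auto_derive; [lra|]; unfold cbrt, Rpower; destruct (Rlt_dec 0 x); [lra|].
      destruct (Rlt_dec x 0); [field; lra|lra].
  - apply (is_derive_ext_loc (fun t => exp (1 / 3 * ln t))).
    + apply (filter_imp (fun t => 0 < t)); [|apply open_gt, L].
      intros t Ht; unfold cbrt; destruct (Rlt_dec 0 t); [auto|lra].
    + auto_derive; [lra|]; unfold cbrt, Rpower; destruct (Rlt_dec 0 x); [field; lra|lra].
Qed.

Lemma C2_facts (a b : Rbar) (f g : R -> R) : class_Cn 2 a b f g ->
  (forall x, inI a b x -> is_derive f x (Derive f x)) /\
  (forall x, inI a b x -> is_derive g x (Derive g x)) /\
  (forall x, inI a b x -> is_derive (Derive f) x (Derive_n f 2 x)) /\
  (forall x, inI a b x -> is_derive (Derive g) x (Derive_n g 2 x)) /\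
  (forall x, inI a b x -> Derive g x <> 0) /\
  (forall x, inI a b x ->
    is_derive (fun t => Derive f t / Derive g t) x (W 2 1 f g x / Derive g x ^ 2)) /\
  (forall x, inI a b x -> W 2 1 f g x <> 0) /\
  cont_on a b (W 2 1 f g).
Proof.
  intros (Hf & Hg & Ng & Np).
  assert (Df := fun x => Cn_on_derive 2 a b f 0 x Hf ltac:(lia)); simpl in Df.
  assert (Dg := fun x => Cn_on_derive 2 a b g 0 x Hg ltac:(lia)); simpl in Dg.
  assert (Df2 := fun x => Cn_on_derive 2 a b f 1 x Hf ltac:(lia)); simpl in Df2.
  assert (Dg2 := fun x => Cn_on_derive 2 a b g 1 x Hg ltac:(lia)); simpl in Dg2.
  assert (Dp : forall x, inI a b x ->
    is_derive (fun t => Derive f t / Derive g t) x (W 2 1 f g x / Derive g x ^ 2)).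
  { intros x Hx; assert (A := Df2 x Hx); assert (B := Dg2 x Hx); assert (N := Ng x Hx).
    evar_last; [apply (is_derive_div (Derive f) (Derive g) x _ _ A B N)|].
    unfold W; simpl; change (Derive (fun y => f y)) with (Derive f).
    change (Derive (fun y => g y)) with (Derive g); field; auto. }
  splits; auto.
  - intros x Hx E; apply (Np x Hx); etransitivity; [apply is_derive_unique, (Dp x Hx)|].
    rewrite E; field; auto.
  - intros x Hx; unfold W.
    assert (C : forall (u v : R -> R), continuous u x -> continuous v x ->
      continuous (fun t => u t * v t) x) by (intros u v; apply (continuous_mult u v)).
    apply (continuous_minus (V := R_NormedModule)
      (fun x => Derive_n f 2 x * Derive_n g 1 x) (fun x => Derive_n f 1 x * Derive_n g 2 x));
      apply C; apply (Cn_on_continuous 2 a b); auto.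
Qed.

Lemma C2_C1 (a b : Rbar) (f g : R -> R) : class_Cn 2 a b f g -> class_C1 a b f g.
Proof.
  intros H; destruct (C2_facts a b f g H) as (_ & _ & _ & Dg2 & Ng & Dp & NW & CW).
  destruct H as (Hf & Hg & _).
  split; [apply (Cn_on_le 1 2); auto|split; [apply (Cn_on_le 1 2); auto|split; auto]].
  apply (strict_mono_derive a b _ _ Dp).
  - intros x Hx E; apply (NW x Hx); assert (N := Ng x Hx).
    apply (Rmult_eq_reg_r (/ Derive g x ^ 2)); [rewrite Rmult_0_l; exact E|].
    apply Rinv_neq_0_compat, pow_nonzero; auto.
  - intros x Hx; apply (continuous_mult (W 2 1 f g) (fun t => / Derive g t ^ 2)); [apply CW, Hx|].
    apply continuous_Rinv_comp; [|apply pow_nonzero; auto].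
    apply (ex_derive_continuous (V := R_NormedModule)).
    assert (A := Dg2 x Hx); auto_derive; repeat split; eexists; eassumption.
Qed.

Lemma cbrt_W_facts (a b : Rbar) (f g : R -> R) : class_Cn 2 a b f g ->
  cont_on a b (Wpow3 1 f g) /\ (forall x, inI a b x -> Wpow3 1 f g x <> 0) /\
  (forall x, Wpow3 1 f g x ^ 3 = W 2 1 f g x).
Proof.
  intros H; destruct (C2_facts a b f g H) as (_ & _ & _ & _ & _ & _ & NW & CW).
  unfold Wpow3; splits.
  - intros x Hx; apply (continuous_ext (fun t => cbrt (W 2 1 f g t)));
      [intros t; symmetry; apply pow_1|].
    apply (continuous_comp (W 2 1 f g) cbrt); [apply CW, Hx|].
    apply (ex_derive_continuous (V := R_NormedModule)); eexists; apply is_derive_cbrt; auto.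
  - intros x Hx; rewrite pow_1; apply cbrt_neq_0; auto.
  - intros x; rewrite pow_1; apply cbrt_cube.
Qed.

Lemma Wpow3_pow (n : nat) (f g : R -> R) (x : R) : Wpow3 n f g x = Wpow3 1 f g x ^ n.
Proof. unfold Wpow3; rewrite pow_1; auto. Qed.

(** The leading form [Q] of the conic is a first integral of the flow, and [F'G - FG'] equals [-2 Q]
    in the variable h. So [W 2 1] is a constant times [k ^ 3], and its cube root is [la * k]. *)
Lemma st_iii_iv (a b : Rbar) (f g : R -> R) : Rbar_lt a b ->
  class_Cn 2 a b f g -> st_iii a b f g -> st_iv a b f g.
Proof.
  intros Hab H2 (al & be & ga & de & ep & et & N & Z); assert (H := C2_C1 a b f g H2).
  destruct (conic_flow a b f g al be ga de ep et H N Z) as (F & G & k & Ck & Nk & Df & Dg & DF & DG).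
  destruct (C2_facts a b f g H2) as (_ & _ & _ & _ & Ng & Dp & NW & _).
  destruct (cbrt_W_facts a b f g H2) as (_ & _ & C3).
  destruct (inI_inhabited a b Hab) as [x0 H0].
  assert (Ef : forall x, inI a b x -> Derive f x = k x * F x)
    by (intros; apply is_derive_unique; auto).
  assert (Eg : forall x, inI a b x -> Derive g x = k x * G x)
    by (intros; apply is_derive_unique; auto).
  assert (NG : forall x, inI a b x -> G x <> 0).
  { intros x Hx E; apply (Ng x Hx); rewrite (Eg x Hx), E; ring. }
  set (Q := fun x => al * F x ^ 2 + be * F x * G x + ga * G x ^ 2).
  assert (Qc : forall x, inI a b x -> Q x = Q x0).
  { intros x Hx; apply (derive_zero_const a b); auto.
    intros t Ht; assert (A := DF t Ht); assert (B := DG t Ht); unfold Q; solve_derive; ring. }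
  assert (EW : forall x, inI a b x -> W 2 1 f g x = - 2 * Q x * k x ^ 3).
  { intros x Hx; assert (A := DF x Hx); assert (B := DG x Hx).
    assert (D : is_derive (fun t => Derive f t / Derive g t) x (- 2 * k x * Q x / G x ^ 2)).
    { apply (is_derive_ext_loc (fun t => F t / G t)).
      - apply (filter_imp (inI a b)); [|apply inI_locally, Hx].
        intros t Ht; change (F t / G t = Derive f t / Derive g t).
        rewrite Ef, Eg by auto; field; auto.
      - evar_last; [apply (is_derive_div F G x _ _ A B (NG x Hx))|]; unfold Q; field; auto. }
    assert (E := is_derive_unique _ _ _ D); rewrite (is_derive_unique _ _ _ (Dp x Hx)) in E.
    transitivity (W 2 1 f g x / Derive g x ^ 2 * Derive g x ^ 2); [field; auto|].
    rewrite E, (Eg x Hx); field; auto. }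
  set (la := cbrt (- 2 * Q x0)).
  assert (Ela : la ^ 3 = - 2 * Q x0) by apply cbrt_cube.
  assert (NQ : Q x0 <> 0).
  { intros E; apply (NW x0 H0); rewrite (EW x0 H0), E; ring. }
  (* At [(f', g')] the leading form is [k ^ 2 * Q x0]; the factor rescales it to [(la * k) ^ 2]. *)
  exists (al * (la ^ 2 / Q x0)), (be * (la ^ 2 / Q x0)), (ga * (la ^ 2 / Q x0)).
  intros x Hx; rewrite Wpow3_pow.
  replace (Wpow3 1 f g x) with (la * k x).
  2: { apply cube_inj; rewrite C3, (EW x Hx), (Qc x Hx), Rpow_mult_distr, Ela; ring. }
  rewrite (Ef x Hx), (Eg x Hx).
  transitivity (la ^ 2 * k x ^ 2 / Q x0 * Q x); [unfold Q; field; exact NQ|].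
  rewrite (Qc x Hx); field; auto.
Qed.

(** In class C_2 the cube root of [W 2 1] is a priori only continuous. Condition (iv) makes its
    square a quadratic form in [f'] and [g'], which is differentiable; as the root has a constant
    sign, it is [sqrt P] up to that sign. *)
Lemma is_derive_of_square (a b : Rbar) (k P : R -> R) (x l : R) :
  cont_on a b k -> (forall t, inI a b t -> k t <> 0) -> (forall t, inI a b t -> P t = k t ^ 2) ->
  inI a b x -> is_derive P x l -> is_derive k x (l / (2 * k x)).
Proof.
  intros Ck Nk E Hx D.
  assert (Pp : 0 < P x) by (rewrite E by auto; assert (T := Nk x Hx); nra).
  assert (S : exists e, e ^ 2 = 1 /\ forall t, inI a b t -> k t = e * sqrt (P t)).
  { destruct (nonzero_sign a b k Ck Nk) as [S|S]; [exists 1|exists (- 1)]; split; try ring;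
      intros t Ht; assert (T := S t Ht); rewrite E by auto.
    - rewrite sqrt_pow2; lra.
    - replace (k t ^ 2) with ((- k t) ^ 2) by ring; rewrite sqrt_pow2; lra. }
  destruct S as (e & He & S).
  apply (is_derive_ext_loc (fun t => e * sqrt (P t))).
  { apply (filter_imp (inI a b)); [intros t Ht; symmetry; auto|apply inI_locally, Hx]. }
  assert (Ns : sqrt (P x) <> 0) by (apply Rgt_not_eq, sqrt_lt_R0, Pp).
  assert (e <> 0) by nra.
  auto_derive; [split; [eexists; eassumption|auto]|].
  change (Derive (fun y => P y)) with (Derive P).
  rewrite (is_derive_unique _ _ _ D), (S x Hx).
  apply (Rmult_eq_reg_r (e * sqrt (P x))); [|apply Rmult_integral_contrapositive; auto].
  field_simplify; auto; rewrite He; field.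
Qed.

(** In [(f'/k)' = (f'' k^2 - f' (k^2)'/2) / k^3], substituting the form of (iv) for [k^2] makes
    [W 2 1] a factor of the numerator, and this cancels [k^3]. The same works for [g]. *)
Lemma st_iv_flow (a b : Rbar) (f g : R -> R) (p q r : R) : class_Cn 2 a b f g ->
  (forall x, inI a b x ->
    p * Derive f x ^ 2 + q * Derive f x * Derive g x + r * Derive g x ^ 2 = Wpow3 2 f g x) ->
  let k := Wpow3 1 f g in
  let F := fun t => Derive f t / k t in
  let G := fun t => Derive g t / k t in
  (forall x, inI a b x -> is_derive F x (k x * (q / 2 * F x + r * G x))) /\
  (forall x, inI a b x -> is_derive G x (- (k x * (p * F x + q / 2 * G x)))).
Proof.
  intros H E k F G.
  destruct (C2_facts a b f g H) as (Df & Dg & Df2 & Dg2 & Ng & Dp & NW & _).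
  destruct (cbrt_W_facts a b f g H) as (Ck & Nk & C3); fold k in Ck, Nk, C3.
  set (P := fun x => p * Derive f x ^ 2 + q * Derive f x * Derive g x + r * Derive g x ^ 2).
  assert (EP : forall x, inI a b x -> P x = k x ^ 2).
  { intros x Hx; unfold P; rewrite (E x Hx), Wpow3_pow; auto. }
  assert (Dk : forall x, inI a b x -> is_derive k x
    ((2 * p * Derive f x * Derive_n f 2 x
      + q * (Derive_n f 2 x * Derive g x + Derive f x * Derive_n g 2 x)
      + 2 * r * Derive g x * Derive_n g 2 x) / (2 * k x))).
  { intros x Hx; apply (is_derive_of_square a b k P); auto.
    assert (A := Df2 x Hx); assert (B := Dg2 x Hx); unfold P.
    solve_derive; ring. }
  assert (Wx : forall x, k x ^ 3 = Derive_n f 2 x * Derive g x - Derive f x * Derive_n g 2 x)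
    by (intros; rewrite C3; reflexivity).
  split; intros x Hx; assert (A := Df2 x Hx); assert (B := Dg2 x Hx); assert (N := Nk x Hx);
    assert (D := Dk x Hx); assert (Px := EP x Hx); assert (W3 := Wx x); unfold P in Px; unfold F, G.
  - evar_last; [apply (is_derive_div (Derive f) k x _ _ A D N)|].
    transitivity ((Derive_n f 2 x * k x ^ 2 - Derive f x * (2 * p * Derive f x * Derive_n f 2 x
      + q * (Derive_n f 2 x * Derive g x + Derive f x * Derive_n g 2 x)
      + 2 * r * Derive g x * Derive_n g 2 x) / 2) / k x ^ 3); [field; auto|].
    rewrite <- Px.
    transitivity ((q / 2 * Derive f x + r * Derive g x) *
      (Derive_n f 2 x * Derive g x - Derive f x * Derive_n g 2 x) / k x ^ 3); [field; auto|].
    rewrite <- W3; field; auto.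
  - evar_last; [apply (is_derive_div (Derive g) k x _ _ B D N)|].
    transitivity ((Derive_n g 2 x * k x ^ 2 - Derive g x * (2 * p * Derive f x * Derive_n f 2 x
      + q * (Derive_n f 2 x * Derive g x + Derive f x * Derive_n g 2 x)
      + 2 * r * Derive g x * Derive_n g 2 x) / 2) / k x ^ 3); [field; auto|].
    rewrite <- Px.
    transitivity (- ((p * Derive f x + q / 2 * Derive g x) *
      (Derive_n f 2 x * Derive g x - Derive f x * Derive_n g 2 x)) / k x ^ 3); [field; auto|].
    rewrite <- W3; field; auto.
Qed.

Lemma antider_W_facts (a b : Rbar) (f g h : R -> R) : class_Cn 2 a b f g ->
  is_antider_W a b f g h -> cont_on a b h /\ strict_mono_on a b h.
Proof.
  intros H D; destruct (cbrt_W_facts a b f g H) as (Ck & Nk & _); split.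
  - exact (cont_on_derive a b h _ D).
  - exact (strict_mono_derive a b h _ D Nk Ck).
Qed.

Lemma st_vi_i (a b : Rbar) (f g : R -> R) : Rbar_lt a b ->
  class_Cn 2 a b f g -> st_vi a b f g -> st_i a b f g.
Proof.
  intros Hab H E; destruct (cbrt_W_facts a b f g H) as (Ck & Nk & _).
  (* Statement (vi) speaks of every antiderivative, so one has to be produced. *)
  destruct (antiderivative_exists a b _ Hab Ck) as [h Dh].
  destruct (antider_W_facts a b f g h H Dh) as [Ch Mh].
  exists h; split; [exact Ch|split; [exact Mh|exact (E h Dh)]].
Qed.

(** * The Bajraktarevic mean *)

Lemma strict_mono_on_ext (a b : Rbar) (u v : R -> R) :
  (forall x, inI a b x -> u x = v x) -> strict_mono_on a b u -> strict_mono_on a b v.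
Proof.
  intros E [H|H]; [left|right]; intros x y Hx Hy L; rewrite <- !E by auto; auto.
Qed.

Lemma bajr_quotient (a b : Rbar) (f g h : R -> R) : class_Cn 2 a b f g ->
  is_antider_W a b f g h -> forall x, inI a b x ->
  Derive f x / Derive h x / (Derive g x / Derive h x) = Derive f x / Derive g x.
Proof.
  intros H Dh x Hx; destruct (cbrt_W_facts a b f g H) as (_ & Nk & _).
  destruct (C2_facts a b f g H) as (_ & _ & _ & _ & Ng & _).
  rewrite (is_derive_unique _ _ _ (Dh x Hx)); field; auto.
Qed.

(** [G = g'/h'] keeps one sign, so [G x + G y] never vanishes and the quotient in the mean is a
    weighted average of values of [F/G] with positive weights. *)
Lemma bajr_denominator_sign (a b : Rbar) (f g h : R -> R) : class_Cn 2 a b f g ->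
  is_antider_W a b f g h -> forall x y, inI a b x -> inI a b y ->
  0 < Derive g x / Derive h x * (Derive g y / Derive h y).
Proof.
  intros H Dh x y Hx Hy; destruct (cbrt_W_facts a b f g H) as (Ck & Nk & _).
  destruct (C2_facts a b f g H) as (_ & _ & _ & Dg2 & Ng & _).
  assert (A := nonzero_same_sign a b _ Ck Nk x y Hx Hy).
  assert (B := nonzero_same_sign a b _ (cont_on_derive a b _ _ Dg2) Ng x y Hx Hy).
  rewrite (is_derive_unique _ _ _ (Dh x Hx)), (is_derive_unique _ _ _ (Dh y Hy)).
  replace (Derive g x / Wpow3 1 f g x * (Derive g y / Wpow3 1 f g y))
    with (Derive g x * Derive g y / (Wpow3 1 f g x * Wpow3 1 f g y)) by (field; auto).
  apply Rdiv_lt_0_compat; auto.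
Qed.

Lemma st_iv_v (a b : Rbar) (f g : R -> R) :
  class_Cn 2 a b f g -> st_iv a b f g -> st_v a b f g.
Proof.
  intros H (p & q & r & E) h Dh F G x y Hx Hy.
  destruct (st_iv_flow a b f g p q r H E) as [DF DG].
  destruct (antider_W_facts a b f g h H Dh) as [Ch Mh].
  destruct (cbrt_W_facts a b f g H) as (Ck & Nk & _).
  destruct (C2_facts a b f g H) as (Df & Dg & _ & _ & Ng & _).
  destruct (qa_mean_spec a b h x y Ch Hx Hy) as [Hm Em].
  set (m := qa_mean a b h x y) in *.
  destruct (linear_flow a b f g h (fun t => Derive f t / Wpow3 1 f g t)
    (fun t => Derive g t / Wpow3 1 f g t) (Wpow3 1 f g) p (q / 2) r Dh)
    with (x := x) (y := y) (m := m) as (_ & c & _ & _ & EF & EG); auto.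
  { intros t Ht; evar_last; [apply (Df t Ht)|]; field; auto. }
  { intros t Ht; evar_last; [apply (Dg t Ht)|]; field; auto. }
  { lra. }
  assert (Sg := bajr_denominator_sign a b f g h H Dh x y Hx Hy).
  assert (Sm := bajr_denominator_sign a b f g h H Dh m m Hm Hm).
  assert (Q := bajr_quotient a b f g h H Dh).
  rewrite <- (is_derive_unique _ _ _ (Dh x Hx)), <- (is_derive_unique _ _ _ (Dh y Hy)),
    <- (is_derive_unique _ _ _ (Dh m Hm)) in EF, EG.
  fold (F x) (F y) (F m) in EF; fold (G x) (G y) (G m) in EG.
  fold (G x) (G y) in Sg; fold (G m) in Sm.
  unfold bajr_mean; apply inv_on_eq; auto.
  - apply (strict_mono_on_ext a b (fun t => Derive f t / Derive g t)).
    + intros t Ht; symmetry; apply Q; auto.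
    + apply (C2_C1 a b f g H).
  - rewrite EF, EG; field; split; intros Z.
    + rewrite Z in Sm; lra.
    + rewrite Z, Rmult_0_l in EG; nra.
Qed.

(** The inverse in [bajr_mean] is an epsilon choice, so (v) carries information only once the
    quotient is known to be a value of [f'/g']. It is a convex combination of the values at [x] and
    [y], hence attained by the intermediate value theorem. *)
Lemma st_v_additive (a b : Rbar) (f g h : R -> R) : class_Cn 2 a b f g -> st_v a b f g ->
  is_antider_W a b f g h -> forall x y, inI a b x -> inI a b y ->
  let m := qa_mean a b h x y in
  Derive f x / Derive h x + Derive f y / Derive h y =
    Derive f m / Derive g m * (Derive g x / Derive h x + Derive g y / Derive h y).
Proof.
  intros H E Dh x y Hx Hy m.
  assert (Em := E h Dh x y Hx Hy); cbv zeta in Em; fold m in Em.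
  destruct (C1_facts a b f g (C2_C1 a b f g H)) as (_ & _ & _ & _ & Cp & _).
  assert (Sg := bajr_denominator_sign a b f g h H Dh x y Hx Hy).
  assert (Qx := bajr_quotient a b f g h H Dh x Hx).
  assert (Qy := bajr_quotient a b f g h H Dh y Hy).
  destruct (antider_W_facts a b f g h H Dh) as [Ch Mh].
  destruct (qa_mean_spec a b h x y Ch Hx Hy) as [Hm _]; fold m in Hm.
  assert (Qm := bajr_quotient a b f g h H Dh m Hm).
  set (Fx := Derive f x / Derive h x) in *; set (Fy := Derive f y / Derive h y) in *.
  set (Gx := Derive g x / Derive h x) in *; set (Gy := Derive g y / Derive h y) in *.
  assert (NGx : Gx <> 0) by (intros Z; rewrite Z in Sg; lra).
  assert (NGy : Gy <> 0) by (intros Z; rewrite Z in Sg; lra).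
  assert (Nsum : Gx + Gy <> 0) by nra.
  assert (Hz : exists z, inI a b z /\ Derive f z / Derive g z = (Fx + Fy) / (Gx + Gy)).
  { apply (cont_on_ivt a b (fun t => Derive f t / Derive g t) x y); auto.
    rewrite <- Qx, <- Qy.
    assert (Wx : 0 < Gx / (Gx + Gy)).
    { replace (Gx / (Gx + Gy)) with ((Gx * Gx + Gx * Gy) / (Gx + Gy) ^ 2) by (field; auto).
      apply Rdiv_lt_0_compat; nra. }
    assert (Wy : 0 < Gy / (Gx + Gy)).
    { replace (Gy / (Gx + Gy)) with ((Gy * Gy + Gx * Gy) / (Gx + Gy) ^ 2) by (field; auto).
      apply Rdiv_lt_0_compat; nra. }
    assert (Ws : Gx / (Gx + Gy) + Gy / (Gx + Gy) = 1) by (field; auto).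
    replace ((Fx + Fy) / (Gx + Gy)) with
      (Gx / (Gx + Gy) * (Fx / Gx) + Gy / (Gx + Gy) * (Fy / Gy)) by (field; auto).
    revert Wx Wy Ws; generalize (Gx / (Gx + Gy)) (Gy / (Gx + Gy)) (Fx / Gx) (Fy / Gy).
    intros u v s t Hu Hv Huv; replace u with (1 - v) in * by lra.
    unfold Rmin, Rmax; destruct (Rle_dec s t); nra. }
  destruct Hz as [z [Iz Ez]].
  assert (Ezm : m = z).
  { rewrite <- Em; unfold bajr_mean; apply inv_on_eq; auto.
    - apply (strict_mono_on_ext a b (fun t => Derive f t / Derive g t)).
      + intros t Ht; symmetry; apply (bajr_quotient a b f g h); auto.
      + apply (C2_C1 a b f g H).
    - rewrite (bajr_quotient a b f g h H Dh z Iz); exact Ez. }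
  rewrite Ezm, Ez; field; auto.
Qed.

Lemma is_derive_inv_on (a b : Rbar) (h : R -> R) (y l : R) :
  cont_on a b h -> strict_mono_on a b h -> inI a b y -> is_derive h y l -> l <> 0 ->
  is_derive (inv_on a b h) (h y) (/ l).
Proof.
  intros Ch Mh Hy Dh Nl; apply is_derive_Reals; apply is_derive_Reals in Dh.
  intros e He.
  assert (Ci : continuous Rinv l).
  { apply (continuous_Rinv_comp (fun s => s)); auto; apply continuous_id. }
  destruct (proj1 (filterlim_locally Rinv (/ l)) Ci (mkposreal e He)) as [e' Hq].
  destruct (Dh e' (cond_pos e')) as [d1 Hd1].
  destruct (inI_locally a b y Hy) as [d2 Hd2].
  set (D := Rmin d1 d2); assert (HD : 0 < D) by (apply Rmin_glb_lt; apply cond_pos).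
  assert (D1 : D <= d1) by apply Rmin_l; assert (D2 : D <= d2) by apply Rmin_r.
  assert (P : forall s, inI (y - D) (y + D) s -> inI a b s).
  { intros s [S1 S2]; simpl in S1, S2; apply Hd2, Rabs_def1; unfold minus, plus, opp; simpl; lra. }
  set (u := y - D / 2); set (v := y + D / 2).
  assert (Ju : inI (y - D) (y + D) u) by (unfold u; split; simpl; lra).
  assert (Jv : inI (y - D) (y + D) v) by (unfold v; split; simpl; lra).
  assert (Iu := P u Ju); assert (Iv := P v Jv).
  assert (B : Rmin (h u) (h v) < h y < Rmax (h u) (h v)).
  { assert (Lu : u < y) by (unfold u; lra); assert (Lv : y < v) by (unfold v; lra).
    unfold Rmin, Rmax; destruct Mh as [M|M]; assert (T1 := M u y Iu Hy Lu);
      assert (T2 := M y v Hy Iv Lv); destruct (Rle_dec (h u) (h v)); lra. }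
  assert (Hdel : 0 < Rmin (h y - Rmin (h u) (h v)) (Rmax (h u) (h v) - h y))
    by (apply Rmin_glb_lt; lra).
  exists (mkposreal _ Hdel); intros z Nz Hz; simpl in Hz.
  apply Rabs_def2 in Hz.
  assert (M1 := Rmin_l (h y - Rmin (h u) (h v)) (Rmax (h u) (h v) - h y)).
  assert (M2 := Rmin_r (h y - Rmin (h u) (h v)) (Rmax (h u) (h v) - h y)).
  (* Finding the preimage [w] inside [(y - D, y + D)] gives at once the continuity of the
     inverse. *)
  destruct (cont_on_ivt (y - D) (y + D) h u v (h y + z)) as [w [Jw Ew]]; auto.
  { intros s Hs; apply Ch, P, Hs. }
  { lra. }
  rewrite (inv_on_eq a b h w (h y + z)), (inv_on_eq a b h y (h y)); auto.
  assert (Nw : w - y <> 0) by (intros Z; replace w with y in Ew by lra; lra).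
  assert (Q := Hd1 (w - y) Nw); replace (y + (w - y)) with w in Q by ring.
  replace ((w - y) / z) with (/ ((h w - h y) / (w - y))).
  2: { rewrite Ew; field; split; auto; lra. }
  apply Hq, Q; destruct Jw as [J1 J2]; simpl in J1, J2; apply Rabs_def1; lra.
Qed.

Lemma derive_zero_segment (z : R -> R) (u v : R) :
  (forall t, Rmin u v <= t <= Rmax u v -> is_derive z t 0) -> z u = z v.
Proof.
  intros D; destruct (Rtotal_order u v) as [L|[->|L]]; auto.
  - rewrite Rmin_left, Rmax_right in D by lra.
    destruct (MVT_cor2 z (fun _ => 0) u v L) as [c [E _]]; [|lra].
    intros c Hc; apply is_derive_Reals; auto.
  - rewrite Rmin_right, Rmax_left in D by lra.
    destruct (MVT_cor2 z (fun _ => 0) v u L) as [c [E _]]; [|lra].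
    intros c Hc; apply is_derive_Reals; auto.
Qed.

(* Integrate the additive form of (v) along the pairs [(s, y s)] whose [h]-mean is fixed. *)
Lemma st_v_vi (a b : Rbar) (f g : R -> R) :
  class_Cn 2 a b f g -> st_v a b f g -> st_vi a b f g.
Proof.
  intros H E h Dh x y Hx Hy.
  assert (H1 := C2_C1 a b f g H).
  assert (Ad := st_v_additive a b f g h H E Dh).
  destruct (antider_W_facts a b f g h H Dh) as [Ch Mh].
  destruct (cbrt_W_facts a b f g H) as (Ck & Nk & _).
  destruct (C2_facts a b f g H) as (Df & Dg & _).
  destruct (qa_mean_spec a b h x y Ch Hx Hy) as [Hm Em].
  set (m := qa_mean a b h x y) in *; set (k := Wpow3 1 f g) in *.
  destruct (Req_EM_T x y) as [Exy|N].
  { rewrite Exy, cauchy_mean_diag; apply (strict_mono_on_inj a b h); auto; rewrite Em, Exy; field. }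
  set (r := Derive f m / Derive g m).
  (* [w s] is the partner of [s] with respect to [m], running from [y] to [m] while [s] runs from
     [x] to [m]. The defect [z] of the chord condition vanishes at [m]; its value at [x] is the
     claim. *)
  set (w := fun s => inv_on a b h (2 * h m - h s)).
  set (z := fun s => f s - f (w s) - r * (g s - g (w s))).
  assert (W0 : forall s, Rmin x m <= s <= Rmax x m -> inI a b s /\ inI a b (w s) /\
    h s + h (w s) = 2 * h m).
  { intros s Hs; assert (Is : inI a b s).
    { unfold Rmin, Rmax in Hs; destruct (Rle_dec x m);
        [apply (inI_convex a b x m)|apply (inI_convex a b m x)]; auto. }
    split; auto.
    assert (Z : exists t, inI a b t /\ h t = 2 * h m - h s).
    { apply (cont_on_ivt a b h m y); auto.
      assert (Bs : Rmin (h x) (h m) <= h s <= Rmax (h x) (h m)).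
      { unfold Rmin at 1, Rmax at 1 in Hs; destruct (Rle_dec x m).
        - apply (strict_mono_on_between a b); auto.
        - rewrite Rmin_comm, Rmax_comm; apply (strict_mono_on_between a b); auto. }
      revert Bs; unfold Rmin, Rmax; destruct (Rle_dec (h x) (h m)), (Rle_dec (h m) (h y)); lra. }
    destruct Z as [t [It Et]].
    unfold w; rewrite (inv_on_eq a b h t) by auto; split; auto; lra. }
  assert (Dz : forall s, Rmin x m <= s <= Rmax x m -> is_derive z s 0).
  { intros s Hs; destruct (W0 s Hs) as (Is & Iw & Ew).
    assert (A1 := Df s Is); assert (A2 := Dg s Is); assert (A3 := Dh s Is); fold k in A3.
    assert (A4 := Df (w s) Iw); assert (A5 := Dg (w s) Iw).
    assert (N1 := Nk s Is); assert (N2 := Nk (w s) Iw).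
    assert (A6 : is_derive (inv_on a b h) (h (w s)) (/ k (w s)))
      by (apply is_derive_inv_on; auto; apply Dh; auto).
    (* The minus sign in [w'] turns the differences in [z] into the sums of the additive
       identity. *)
    assert (A7 : is_derive w s (- (k s / k (w s)))).
    { unfold w at 1; replace (h (w s)) with (2 * h m + - h s) in A6 by lra.
      solve_derive; unfold Rdiv; ring. }
    assert (Q := Ad s (w s) Is Iw); cbv zeta in Q.
    rewrite (qa_mean_eq a b h s (w s) m Mh Hm Ew) in Q; fold r in Q.
    rewrite (is_derive_unique _ _ _ A3), (is_derive_unique _ _ _ (Dh (w s) Iw)) in Q.
    fold k in Q.
    unfold z; evar_last.
    - apply (is_derive_minus (V := R_NormedModule) (fun s => f s - f (w s))
        (fun s => r * (g s - g (w s)))).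
      + apply (is_derive_minus (V := R_NormedModule) f (fun s => f (w s))); [exact A1|].
        apply (is_derive_comp f w); [exact A4|exact A7].
      + apply (is_derive_scal (fun s => g s - g (w s))).
        apply (is_derive_minus (V := R_NormedModule) g (fun s => g (w s))); [exact A2|].
        apply (is_derive_comp g w); [exact A5|exact A7].
    - unfold minus, plus, opp, scal; simpl; unfold mult; simpl.
      transitivity (k s * (Derive f s / k s + Derive f (w s) / k (w s)
        - r * (Derive g s / k s + Derive g (w s) / k (w s)))); [field; auto|].
      rewrite Q; ring. }
  assert (Ez := derive_zero_segment z x m Dz).
  assert (Wx : w x = y) by (apply inv_on_eq; auto; lra).
  assert (Wm : w m = m) by (apply inv_on_eq; auto; lra).
  unfold z in Ez; rewrite Wx, Wm in Ez.
  apply cauchy_mean_eq; auto; fold r; lra.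
Qed.

(** * The fourth order condition *)

Definition theta (f g : R -> R) (x : R) : R :=
  (3 * W 4 1 f g x + 12 * W 3 2 f g x) / Wpow3 5 f g x
    - 5 * (W 3 1 f g x ^ 2 / Wpow3 8 f g x).

(* The derivative of [u' / k] with respect to an antiderivative of [k = (W 2 1 f g) ^ (1/3)]. *)
Definition second_h_derivative (f g u : R -> R) (t : R) : R :=
  (Derive_n u 2 t * Wpow3 1 f g t
    - Derive_n u 1 t * (W 3 1 f g t / (3 * Wpow3 1 f g t ^ 2))) / Wpow3 1 f g t ^ 3.

Lemma class_Cn_le (m n : nat) (a b : Rbar) (f g : R -> R) :
  (m <= n)%nat -> class_Cn n a b f g -> class_Cn m a b f g.
Proof.
  intros L (Hf & Hg & H); split; [apply (Cn_on_le m n); auto|split; auto; apply (Cn_on_le m n); auto].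
Qed.

Lemma W_derivatives (a b : Rbar) (f g : R -> R) : class_Cn 4 a b f g ->
  forall x, inI a b x -> is_derive (W 2 1 f g) x (W 3 1 f g x) /\
    is_derive (W 3 1 f g) x (W 4 1 f g x + W 3 2 f g x).
Proof.
  intros (Hf & Hg & _) x Hx.
  assert (Df := fun j Hj => Cn_on_derive 4 a b f j x Hf Hj Hx).
  assert (Dg := fun j Hj => Cn_on_derive 4 a b g j x Hg Hj Hx).
  assert (f1 := Df 1%nat ltac:(lia)); assert (f2 := Df 2%nat ltac:(lia));
    assert (f3 := Df 3%nat ltac:(lia)).
  assert (g1 := Dg 1%nat ltac:(lia)); assert (g2 := Dg 2%nat ltac:(lia));
    assert (g3 := Dg 3%nat ltac:(lia)).
  clear Df Dg; unfold W.
  revert f1 f2 f3 g1 g2 g3.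
  generalize (Derive_n f 1) (Derive_n f 2) (Derive_n f 3) (Derive_n f 4)
    (Derive_n g 1) (Derive_n g 2) (Derive_n g 3) (Derive_n g 4).
  intros u1 u2 u3 u4 v1 v2 v3 v4 f1 f2 f3 g1 g2 g3; split; solve_derive; ring.
Qed.

Lemma cbrt_W_derivative (a b : Rbar) (f g : R -> R) : class_Cn 4 a b f g ->
  forall x, inI a b x ->
    is_derive (Wpow3 1 f g) x (W 3 1 f g x / (3 * Wpow3 1 f g x ^ 2)).
Proof.
  intros H x Hx; assert (H2 := class_Cn_le 2 4 a b f g ltac:(lia) H).
  destruct (W_derivatives a b f g H x Hx) as [D _].
  destruct (cbrt_W_facts a b f g H2) as (_ & Nk & _).
  destruct (C2_facts a b f g H2) as (_ & _ & _ & _ & _ & _ & NW & _).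
  apply (is_derive_ext (fun t => cbrt (W 2 1 f g t))); [intros t; symmetry; apply pow_1|].
  evar_last; [apply (is_derive_comp cbrt (W 2 1 f g)); [apply is_derive_cbrt; auto|exact D]|].
  specialize (Nk x Hx); unfold Wpow3 in *; rewrite pow_1 in *.
  unfold scal; simpl; unfold mult; simpl; field; auto.
Qed.

(** The hypothesis says that [y = u'] solves [W 2 1 * y'' = W 3 1 * y' - W 3 2 * y]; for [f] and [g]
    it is the expansion of a determinant with a repeated row. It eliminates the third derivative of
    [u]. Division by [k] and the variable h then remove the first order term, leaving [-theta / 9]
    as potential. *)
Lemma h_derivatives (a b : Rbar) (f g u : R -> R) : class_Cn 4 a b f g -> Cn_on 4 a b u ->
  forall x, inI a b x ->
  Derive_n u 3 x * W 2 1 f g x = Derive_n u 2 x * W 3 1 f g x - Derive_n u 1 x * W 3 2 f g x ->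
  is_derive (fun t => Derive u t / Wpow3 1 f g t) x (Wpow3 1 f g x * second_h_derivative f g u x) /\
  is_derive (second_h_derivative f g u) x
    (Wpow3 1 f g x * (- theta f g x / 9 * (Derive u x / Wpow3 1 f g x))).
Proof.
  intros H Hu x Hx E; assert (H2 := class_Cn_le 2 4 a b f g ltac:(lia) H).
  destruct (W_derivatives a b f g H x Hx) as [_ D3].
  assert (Dk := cbrt_W_derivative a b f g H x Hx).
  destruct (cbrt_W_facts a b f g H2) as (_ & Nk & C3); specialize (Nk x Hx); specialize (C3 x).
  assert (D1 : is_derive (Derive u) x (Derive_n u 2 x))
    by exact (Cn_on_derive 4 a b u 1 x Hu ltac:(lia) Hx).
  assert (D2 := Cn_on_derive 4 a b u 2 x Hu ltac:(lia) Hx).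
  unfold second_h_derivative, theta; rewrite (Wpow3_pow 5), (Wpow3_pow 8).
  change (Derive_n u 1) with (Derive u) in *.
  rewrite <- C3 in E.
  assert (E3 : Derive_n u 3 x =
    (Derive_n u 2 x * W 3 1 f g x - Derive u x * W 3 2 f g x) / Wpow3 1 f g x ^ 3).
  { rewrite <- E; field; auto. }
  rewrite E3 in D2; clear E E3 C3.
  revert D1 D2 D3 Dk Nk.
  generalize (W 4 1 f g x) (W 3 2 f g x) (W 3 1 f g) (Wpow3 1 f g) (Derive u) (Derive_n u 2).
  intros w41 w32 w31 k u1 u2 D1 D2 D3 Dk Nk.
  assert (Nk2 : k x * (k x * 1) <> 0) by (repeat apply Rmult_integral_contrapositive_currified; auto).
  split.
  - evar_last; [apply (is_derive_div u1 k x _ _ D1 Dk Nk)|]; field; auto.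
  - solve_derive; try lra;
      try (simpl; repeat apply Rmult_integral_contrapositive_currified; auto; lra).
    field; auto.
Qed.

Lemma h_derivatives_pair (a b : Rbar) (f g : R -> R) : class_Cn 4 a b f g ->
  forall x, inI a b x ->
  (is_derive (fun t => Derive f t / Wpow3 1 f g t) x (Wpow3 1 f g x * second_h_derivative f g f x) /\
   is_derive (second_h_derivative f g f) x
    (Wpow3 1 f g x * (- theta f g x / 9 * (Derive f x / Wpow3 1 f g x)))) /\
  (is_derive (fun t => Derive g t / Wpow3 1 f g t) x (Wpow3 1 f g x * second_h_derivative f g g x) /\
   is_derive (second_h_derivative f g g) x
    (Wpow3 1 f g x * (- theta f g x / 9 * (Derive g x / Wpow3 1 f g x)))).
Proof.
  intros H x Hx; split; apply (h_derivatives a b f g); auto; try apply H; unfold W; ring.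
Qed.

Lemma st_iv_vii (a b : Rbar) (f g : R -> R) :
  class_Cn 4 a b f g -> st_iv a b f g -> st_vii a b f g.
Proof.
  intros H (p & q & r & E); assert (H2 := class_Cn_le 2 4 a b f g ltac:(lia) H).
  destruct (st_iv_flow a b f g p q r H2 E) as [DF DG].
  destruct (cbrt_W_facts a b f g H2) as (_ & Nk & _).
  destruct (C2_facts a b f g H2) as (_ & _ & _ & _ & Ng & _).
  exists (- 9 * (q / 2 * (q / 2) - p * r)); intros x Hx.
  change (theta f g x = - 9 * (q / 2 * (q / 2) - p * r)).
  (* The two expressions for the second h-derivative are compared on [G], which has no zeros: the
     squared matrix of the flow gives [(q / 2) ^ 2 - p * r], the general formula gives
     [- theta / 9]. *)
  destruct (h_derivatives_pair a b f g H x Hx) as [_ [_ D2]].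
  set (F := fun t => Derive f t / Wpow3 1 f g t) in *.
  set (G := fun t => Derive g t / Wpow3 1 f g t) in *; cbv zeta in DF, DG.
  assert (D2' : is_derive (second_h_derivative f g g) x
    (Wpow3 1 f g x * ((q / 2 * (q / 2) - p * r) * G x))).
  { apply (is_derive_ext_loc (fun t => - (p * F t + q / 2 * G t))).
    - apply (filter_imp (inI a b)); [|apply inI_locally, Hx].
      intros t Ht; destruct (h_derivatives_pair a b f g H t Ht) as [_ [D1 _]].
      assert (U := eq_trans (eq_sym (is_derive_unique _ _ _ D1)) (is_derive_unique _ _ _ (DG t Ht))).
      apply (Rmult_eq_reg_l (Wpow3 1 f g t)); auto.
      change (Wpow3 1 f g t * - (p * F t + q / 2 * G t)
        = Wpow3 1 f g t * second_h_derivative f g g t).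
      rewrite U; unfold F, G; ring.
    - assert (A := DF x Hx); assert (B := DG x Hx); fold (F x) (G x) in A, B.
      fold F in A; fold G in B.
      solve_derive; field. }
  assert (U := eq_trans (eq_sym (is_derive_unique _ _ _ D2')) (is_derive_unique _ _ _ D2)).
  assert (NG : G x <> 0).
  { unfold G; intros Z; apply (Ng x Hx).
    transitivity (Derive g x / Wpow3 1 f g x * Wpow3 1 f g x); [field; auto|rewrite Z; ring]. }
  fold (G x) in U; apply (Rmult_eq_reg_l (Wpow3 1 f g x * G x)).
  - transitivity (- 9 * (Wpow3 1 f g x * (- theta f g x / 9 * G x))); [field|].
    rewrite <- U; ring.
  - apply Rmult_integral_contrapositive; auto.
Qed.

(* With [F'' = kap F] and [G'' = kap G] in the variable [h] and [F' G - F G' = 1], the quadratic form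
   below has constant coefficients and takes the value [(F' G - F G') ^ 2 = 1]. *)
Lemma st_vii_iv (a b : Rbar) (f g : R -> R) : Rbar_lt a b ->
  class_Cn 4 a b f g -> st_vii a b f g -> st_iv a b f g.
Proof.
  intros Hab H (K & E); assert (H2 := class_Cn_le 2 4 a b f g ltac:(lia) H).
  destruct (cbrt_W_facts a b f g H2) as (_ & Nk & C3).
  destruct (inI_inhabited a b Hab) as [x0 H0].
  assert (D := h_derivatives_pair a b f g H).
  set (kap := - K / 9).
  set (F := fun t => Derive f t / Wpow3 1 f g t) in *.
  set (G := fun t => Derive g t / Wpow3 1 f g t) in *.
  set (F1 := second_h_derivative f g f) in *; set (G1 := second_h_derivative f g g) in *.
  (* The energies [y' ^ 2 - kap * y ^ 2] of the solutions [G] and [F] of [y'' = kap * y], and their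
     polarization [Q], are first integrals. *)
  set (P := fun t => G1 t ^ 2 - kap * G t ^ 2).
  set (Q := fun t => F1 t * G1 t - kap * F t * G t).
  set (R := fun t => F1 t ^ 2 - kap * F t ^ 2).
  assert (Z : forall x, inI a b x -> is_derive P x 0 /\ is_derive Q x 0 /\ is_derive R x 0).
  { intros x Hx; destruct (D x Hx) as [[A1 A2] [B1 B2]].
    assert (T : theta f g x = K) by exact (E x Hx); rewrite T in A2, B2; fold kap in A2, B2.
    fold (F x) in A2; fold (G x) in B2; unfold P, Q, R.
    change (is_derive F x (Wpow3 1 f g x * F1 x)) in A1.
    change (is_derive G x (Wpow3 1 f g x * G1 x)) in B1.
    clearbody F G F1 G1; splits; solve_derive; ring. }
  exists (P x0), (- 2 * Q x0), (R x0); intros x Hx; rewrite Wpow3_pow.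
  rewrite (derive_zero_const a b P (fun x Hx => proj1 (Z x Hx)) x0 x H0 Hx).
  rewrite (derive_zero_const a b Q (fun x Hx => proj1 (proj2 (Z x Hx))) x0 x H0 Hx).
  rewrite (derive_zero_const a b R (fun x Hx => proj2 (proj2 (Z x Hx))) x0 x H0 Hx).
  specialize (Nk x Hx); specialize (C3 x).
  assert (Wr : F1 x * G x - F x * G1 x = 1).
  { unfold F1, G1, F, G, second_h_derivative.
    change (Derive_n f 1 x) with (Derive f x); change (Derive_n g 1 x) with (Derive g x).
    transitivity ((Derive_n f 2 x * Derive g x - Derive f x * Derive_n g 2 x) / Wpow3 1 f g x ^ 3);
      [field; auto|].
    change (W 2 1 f g x / Wpow3 1 f g x ^ 3 = 1); rewrite <- C3; field; auto. }
  transitivity (Wpow3 1 f g x ^ 2 * (F1 x * G x - F x * G1 x) ^ 2); [|rewrite Wr; ring].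
  replace (Derive f x) with (Wpow3 1 f g x * F x) by (unfold F; field; auto).
  replace (Derive g x) with (Wpow3 1 f g x * G x) by (unfold G; field; auto).
  unfold P, Q, R; ring.
Qed.

Theorem theorem2p3 (a b : Rbar) (f g : R -> R) (Hab : Rbar_lt a b) :
  (class_C1 a b f g ->
     (st_i a b f g <-> st_ii a b f g) /\ (st_i a b f g <-> st_iii a b f g)) /\
  (class_Cn 2 a b f g ->
     (st_i a b f g <-> st_ii a b f g) /\ (st_i a b f g <-> st_iii a b f g) /\
     (st_i a b f g <-> st_iv a b f g) /\ (st_i a b f g <-> st_v a b f g) /\
     (st_i a b f g <-> st_vi a b f g)) /\
  (class_Cn 4 a b f g ->
     (st_i a b f g <-> st_ii a b f g) /\ (st_i a b f g <-> st_iii a b f g) /\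
     (st_i a b f g <-> st_iv a b f g) /\ (st_i a b f g <-> st_v a b f g) /\
     (st_i a b f g <-> st_vi a b f g) /\ (st_i a b f g <-> st_vii a b f g)).
Proof.
  assert (A1 : class_C1 a b f g ->
    (st_i a b f g <-> st_ii a b f g) /\ (st_i a b f g <-> st_iii a b f g)).
  { intros H; assert (X := st_i_ii a b f g H); assert (Y := st_ii_iii a b f g Hab H).
    assert (Z := st_iii_i a b f g Hab H); tauto. }
  assert (A2 : class_Cn 2 a b f g ->
    (st_i a b f g <-> st_iv a b f g) /\ (st_i a b f g <-> st_v a b f g) /\
    (st_i a b f g <-> st_vi a b f g)).
  { intros H; assert (X := A1 (C2_C1 a b f g H)).
    assert (Y1 := st_iii_iv a b f g Hab H); assert (Y2 := st_iv_v a b f g H).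
    assert (Y3 := st_v_vi a b f g H); assert (Y4 := st_vi_i a b f g Hab H); tauto. }
  split; [exact A1|split; intros H].
  - assert (X := A1 (C2_C1 a b f g H)); assert (Y := A2 H); tauto.
  - assert (H2 := class_Cn_le 2 4 a b f g ltac:(lia) H).
    assert (X := A1 (C2_C1 a b f g H2)); assert (Y := A2 H2).
    assert (Z1 := st_iv_vii a b f g H); assert (Z2 := st_vii_iv a b f g Hab H); tauto.
Qed.
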